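(* Let $f_1,\ldots,f_s\in A=\mathbb{R}[x_1,\ldots,x_n]$ and let $A=\bigoplus_{d\in\mathbb{Z}}A^{(z)}_d$ be the $z$-grading, where $z\in\mathbb{Z}^n$. If the set $S(f_1,\ldots,f_s)\subseteq\mathbb{R}^n$ contains some rational tentacle $T_{K,\varphi}$ of degree $z$, then the quadratic module $M=\mathrm{QM}(f_1,\ldots,f_s)$ is totally stable with respect to the $z$-grading. If $M$ is closed under multiplication, then $S(f_1,\ldots,f_s)$ must contain a tentacle $T_{K,z}$ for $M$ to be totally stable with respect to the $z$-grading; that is, if $M$ is closed under multiplication and totally stable with respect to the $z$-grading, then $T_{K,z}\subseteq S(f_1,\ldots,f_s)$ for some compact set $K\subseteq\mathbb{R}^n$ with non-empty interior.
   Context: For $h_1,\ldots,h_s\in A=\mathbb{R}[x_1,\ldots,x_n]$, $S(h_1,\ldots,h_s)=\{x\in\mathbb{R}^n:h_1(x)\geq 0,\ldots,h_s(x)\geq 0\}$, and $\mathrm{QM}(h_1,\ldots,h_s)=\{\sigma_0+\sigma_1h_1+\cdots+\sigma_sh_s:\sigma_0,\ldots,\sigma_s\in\Sigma A^2\}$ is the quadratic module generated by $h_1,\ldots,h_s$, where $\Sigma A^2$ is the set of sums of squares in $A$. For $z\in\mathbb{Z}^n$ the $z$-grading of $A$ is $A=\bigoplus_{d\in\mathbb{Z}}A^{(z)}_d$, where $A^{(z)}_d$ is the span of the monomials $x_1^{\delta_1}\cdots x_n^{\delta_n}$, $\delta\in\mathbb{N}_0^n$, with $\langle z,\delta\rangle=z_1\delta_1+\cdots+z_n\delta_n=d$.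 The degree of a non-zero polynomial with respect to the $z$-grading is the largest $d$ for which its component in $A^{(z)}_d$ is non-zero, and $\deg(0)=-\infty$. A finitely generated quadratic module $M\subseteq A$ is totally stable with respect to the $z$-grading if $\deg(f)\leq\deg(f+g)$ for all $f,g\in M$, where $\deg$ is the degree with respect to the $z$-grading. Tentacles: for a compact set $K\subseteq\mathbb{R}^n$ with non-empty interior and $z\in\mathbb{Z}^n$, $T_{K,z}=\{(\lambda^{z_1}x_1,\ldots,\lambda^{z_n}x_n):\lambda\geq 1,\ x=(x_1,\ldots,x_n)\in K\}$. Rational tentacles: for a tuple $\varphi=(\varphi_1,\ldots,\varphi_n)\in\mathbb{R}(\lambda)^n$ of non-zero rational functions in one variable $\lambda$ and a compact set $K\subseteq\mathbb{R}^n$ with non-empty interior, $$T_{K,\varphi}=\{(\varphi_1(\lambda)x_1,\ldots,\varphi_n(\lambda)x_n):\lambda\geq 1,\ \varphi_1(\lambda),\ldots,\varphi_n(\lambda)\text{ are defined},\ x\in K\}.$$ The degree of a rational function is numerator degree minus denominator degree. A rational tentacle $T$ is of degree $z\in\mathbb{Z}^n$ if there exist a compact set $K\subseteq\mathbb{R}^n$ with non-empty interior and a tuple $\varphi=(\varphi_1,\ldots,\varphi_n)\in\mathbb{R}(\lambda)^n$ of non-zero rational functions with $T=T_{K,\varphi}$ and $(\deg\varphi_1,\ldots,\deg\varphi_n)=z$. *)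

(* Defs.v *)
From HB Require Import structures.
From mathcomp Require Import all_boot all_order all_algebra.
(* The notations of mpoly clash with those of mathcomp-analysis. *)
From mathcomp Require Import -(notations) mpoly.
From mathcomp Require Import zify.
From mathcomp Require Import all_classical all_reals all_analysis.
Set Implicit Arguments.
Unset Strict Implicit.
Unset Printing Implicit Defensive.
Import Order.TTheory GRing.Theory Num.Theory.
Import numFieldNormedType.Exports.
Local Open Scope classical_set_scope.
Local Open Scope ring_scope.

Section Grading.
Variables (R : realType) (n : nat).
Implicit Types (z : 'I_n -> int) (p : mpoly n R).

Definition zweight z (m : multinom n) : int := \sum_(i < n) z i * (m i)%:Z.

(* The component of [p] in the span of the monomials of weight [d]. *)
Definition zcomp z (d : int) p : mpoly n R :=
  \sum_(m <- msupp p | zweight z m == d) mcoeff m p *: mpolyX R m.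

(* Every [d] with a nonzero component is the weight of a monomial of [p], so
   that the maximum below ranges over all of them; see [zdegP]. *)
Definition zdeg z p : \bar int :=
  \big[maxe/-oo%E]_(d <- [seq zweight z m | m <- msupp p] | zcomp z d p != 0)
    d%:E.

Lemma mcoeff_zcomp z d p m :
  mcoeff m (zcomp z d p) = if zweight z m == d then mcoeff m p else 0.
Proof.
rewrite /zcomp big_mkcond raddf_sum /=.
have E k : mcoeff m (if zweight z k == d then mcoeff k p *: mpolyX R k else 0)
    = if k == m then (if zweight z m == d then mcoeff m p else 0) else 0.
  case: (eqVneq k m) => [->|/negbTE km].
    by case: ifP; rewrite ?mcoeff0 // mcoeffZ mcoeffX eqxx mulr1.
  by case: ifP; rewrite ?mcoeff0 // mcoeffZ mcoeffX km mulr0.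
under eq_bigr do rewrite E.
case: (boolP (m \in msupp p)) => mp.
  by rewrite (bigD1_seq m) ?msupp_uniq //= eqxx big1 ?addr0 // => k /negbTE ->.
rewrite (memN_msupp_eq0 mp) if_same big1 // => k _; exact: if_same.
Qed.

Lemma zdeg0 z : zdeg z 0 = -oo%E.
Proof. by rewrite /zdeg msupp0 big_nil. Qed.

Lemma zcomp_weight z d p :
  zcomp z d p != 0 -> d \in [seq zweight z m | m <- msupp p].
Proof.
apply: contraNT => dp; apply/eqP/mpolyP => m; rewrite mcoeff_zcomp mcoeff0.
case: eqP => // md; apply: memN_msupp_eq0; apply: contra dp => mp.
by apply/mapP; exists m.
Qed.

Lemma zdegP z p : p != 0 ->
  exists d, [/\ zdeg z p = d%:E, zcomp z d p != 0 &
    forall e, zcomp z e p != 0 -> e <= d].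
Proof.
have bigmaxP (P : pred int) (r : seq int) : has P r ->
    exists d, [/\ \big[maxe/-oo%E]_(d <- r | P d) d%:E = d%:E, P d &
      forall e, e \in r -> P e -> e <= d].
  elim: r => // x r IH /=; rewrite big_cons.
  have [Pr _|Pr /=] := boolP (has P r); last first.
    rewrite orbF => Px; exists x; rewrite Px big_hasC // maxeNy; split=> // e.
    rewrite inE => /predU1P[->//|er Pe]; case/hasP: Pr; by exists e.
  have [d [-> Pd dmax]] := IH Pr.
  case: ifPn => Px; last first.
    exists d; split=> // e; rewrite inE => /predU1P[->|]; last exact: dmax.
    by rewrite (negbTE Px).
  exists (Num.max x d); split; first by rewrite EFin_max.
    by rewrite maxEle; case: ifP.
  move=> e; rewrite inE le_max => /predU1P[->|er Pe]; first by rewrite lexx.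
  by rewrite dmax ?orbT.
move=> p0; case: (bigmaxP (fun d => zcomp z d p != 0)
    [seq zweight z m | m <- msupp p]).
  have mp := mlead_supp p0; apply/hasP; exists (zweight z (mlead p)).
    by apply/mapP; exists (mlead p).
  apply/eqP => /(congr1 (mcoeff (mlead p))).
  by rewrite mcoeff_zcomp eqxx mcoeff0; apply/eqP; rewrite mleadc_eq0.
move=> d [dE d0 dmax]; exists d; split=> // e e0.
by apply: dmax => //; exact: zcomp_weight.
Qed.

End Grading.

Section QuadraticModule.
Variables (R : realType) (n s : nat).
Implicit Types (f : 'I_s -> mpoly n R) (M : set (mpoly n R)).

Definition basic_closed f : set 'rV[R]_n :=
  [set x : 'rV[R]_n | forall i, 0 <= meval (fun j => x ord0 j) (f i)].

Definition sum_of_squares : set (mpoly n R) :=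
  [set p | exists t : seq (mpoly n R), p = \sum_(q <- t) q ^+ 2].

Definition quadratic_module f : set (mpoly n R) :=
  [set p | exists (sigma0 : mpoly n R) (sigma : 'I_s -> mpoly n R),
    [/\ sum_of_squares sigma0, forall i, sum_of_squares (sigma i) &
        p = sigma0 + \sum_(i < s) sigma i * f i]].

Definition mul_closed M := forall p q, M p -> M q -> M (p * q).

Definition totally_stable (z : 'I_n -> int) M :=
  forall p q, M p -> M q -> (zdeg z p <= zdeg z (p + q)%R)%E.

End QuadraticModule.

(* Rational functions are evaluated on their reduced form, so that they are
   undefined exactly at their poles. *)
Section RationalFunction.
Variable R : realType.
Implicit Types (phi : {fraction {poly R}}) (l : R).

Local Notation "x %:F" := (FracField.tofrac x).

Definition rat_num phi : {poly R} :=
  (repr phi).1 %/ gcdp (repr phi).1 (repr phi).2.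

Definition rat_den phi : {poly R} :=
  (repr phi).2 %/ gcdp (repr phi).1 (repr phi).2.

Definition rat_defined phi l := (rat_den phi).[l] != 0.

Definition rat_eval phi l : R := (rat_num phi).[l] / (rat_den phi).[l].

(* Meaningful for [phi != 0]; [size] is one more than the degree. *)
Definition rat_deg phi : int :=
  (size (rat_num phi))%:Z - (size (rat_den phi))%:Z.

Lemma frac_repr phi : phi = (repr phi).1%:F / (repr phi).2%:F.
Proof.
have dF : (repr phi).2%:F != 0 by rewrite tofrac_eq0 denom_ratioP.
apply: (mulIf dF); rewrite divfK // -{1}[phi]reprK.
unlock FracField.tofrac; rewrite -[LHS]FracField.pi_mul.
apply/eqmodP => /=; rewrite /FracField.equivf /= /FracField.mulf.
rewrite !numden_Ratio ?oner_neq0 ?mulf_neq0 ?denom_ratioP ?oner_neq0 //.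
by rewrite !mulr1 mulrC.
Qed.

Lemma rat_num_den phi :
  [/\ phi = (rat_num phi)%:F / (rat_den phi)%:F, rat_den phi != 0 &
      coprimep (rat_num phi) (rat_den phi)].
Proof.
set g := gcdp (repr phi).1 (repr phi).2.
have g0 : g != 0 by rewrite gcdp_eq0 negb_and denom_ratioP orbT.
have En : (repr phi).1 = rat_num phi * g by rewrite divpK // dvdp_gcdl.
have Ed : (repr phi).2 = rat_den phi * g by rewrite divpK // dvdp_gcdr.
have d0 : rat_den phi != 0.
  by apply: contraNneq (denom_ratioP (repr phi)) => d0; rewrite Ed d0 mul0r.
split=> //; last by apply: coprimep_div_gcd; rewrite denom_ratioP orbT.
have g0F : g%:F != 0 by rewrite tofrac_eq0.
rewrite {1}(frac_repr phi) En Ed !tofracM invfM mulrACA divff ?mulr1 //.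
Qed.

Lemma rat_num_den_cross (p q : {poly R}) : q != 0 ->
  p * rat_den (p%:F / q%:F) = rat_num (p%:F / q%:F) * q.
Proof.
move=> q0; have [E d0 _] := rat_num_den (p%:F / q%:F).
move: E d0; set a := rat_num _; set b := rat_den _ => E b0.
apply/eqP; rewrite -tofrac_eq !tofracM -eqr_div ?tofrac_eq0 //; exact/eqP.
Qed.

Lemma rat_degE (p q : {poly R}) : p != 0 -> q != 0 ->
  rat_deg (p%:F / q%:F) = (size p)%:Z - (size q)%:Z.
Proof.
move=> p0 q0; have := rat_num_den_cross p q0.
have [E d0 _] := rat_num_den (p%:F / q%:F).
rewrite /rat_deg; move: E d0; set a := rat_num _; set b := rat_den _ => E b0.
have a0 : a != 0.
  have : p%:F / q%:F != 0 by rewrite mulf_neq0 ?invr_eq0 ?tofrac_eq0.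
  by rewrite E; apply: contraNneq => ->; rewrite tofrac0 mul0r.
move=> /(congr1 (fun r : {poly R} => size r)); rewrite !size_mul //.
move: p0 q0 a0 b0; rewrite -!size_poly_gt0.
by move: (size p) (size q) (size a) (size b); lia.
Qed.

Lemma rat_evalE (p q : {poly R}) l : q.[l] != 0 ->
  rat_defined (p%:F / q%:F) l /\ rat_eval (p%:F / q%:F) l = p.[l] / q.[l].
Proof.
move=> ql; have q0 : q != 0 by apply: contraNneq ql => ->; rewrite horner0.
have := rat_num_den_cross p q0.
have [_ _] := rat_num_den (p%:F / q%:F); rewrite /rat_defined /rat_eval.
set a := rat_num _; set b := rat_den _ => ab pb.
have bl : b.[l] != 0.
  apply: contraTneq ab => bl0; apply: contraNN ql => /coprimep_root ab.
  have := congr1 (horner^~ l) pb; rewrite !hornerM bl0 mulr0 => /esym/eqP.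
  rewrite mulf_eq0 => /orP[al0|//].
  by have := ab l al0; rewrite bl0 eqxx.
split=> //; apply/eqP; rewrite eqr_div // -!hornerM -pb; exact/eqP.
Qed.

End RationalFunction.

Section Tentacle.
Variables (R : realType) (n : nat).
Implicit Types (K T : set 'rV[R]_n) (z : 'I_n -> int).

Definition compact_with_interior K := compact K /\ K^° !=set0.

Definition tentacle K z : set 'rV[R]_n :=
  [set y : 'rV[R]_n | exists (l : R) (x : 'rV[R]_n),
    [/\ 1 <= l, K x & y = \row_(i < n) (l ^ z i * x ord0 i)]].

Definition rational_tentacle K (phi : 'I_n -> {fraction {poly R}}) :
    set 'rV[R]_n :=
  [set y : 'rV[R]_n | exists (l : R) (x : 'rV[R]_n),
    [/\ 1 <= l, forall i, rat_defined (phi i) l, K x &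
        y = \row_(i < n) (rat_eval (phi i) l * x ord0 i)]].

Definition rational_tentacle_of_degree z T :=
  exists K (phi : 'I_n -> {fraction {poly R}}),
    [/\ compact_with_interior K, forall i, phi i != 0,
        T = rational_tentacle K phi &
        forall i, rat_deg (phi i) = z i].

End Tentacle.

(* Main.v *)
Require Import Defs.
From HB Require Import structures.
From mathcomp Require Import all_boot all_order all_algebra.
From mathcomp Require Import -(notations) mpoly.
From mathcomp Require Import qe_rcf_th complex.
From mathcomp Require Import all_classical all_reals all_analysis.
From mathcomp Require Import ring lra zify.
Import Order.TTheory GRing.Theory Num.Theory.
Import numFieldNormedType.Exports.
Local Open Scope classical_set_scope.
Local Open Scope ring_scope.

(** Write [p_d] for the component of weight [d] of [p].  Both directions come
    down to leading components, seen through the rescaled polynomial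
    [mu ^ d * p (mu ^ - z_1 v_1, ..., mu ^ - z_n v_n)]: when no weight of [p]
    exceeds [d], it is polynomial in [(mu, v)] and takes the value [p_d v] at
    [mu = 0].

    A tentacle forces stability.  Substituting the rational functions for the
    variables and letting the parameter go to infinity, an element of weight at
    most [d] of the quadratic module has a component [p_d] that is nonnegative
    on a nonempty open set ([rational_tentacle_leading_ge0]).  If adding [q]
    lowered the degree [d] of [p], then [q_d = - p_d] would be nonnegative there
    too, so [p_d] would vanish on an open set and be zero.

    Stability forces a tentacle.  If the module is closed under multiplication
    and totally stable, take the leading components [h_i] of the nonzero
    generators.  The terms [q ^ 2 * prod h_i] of the preordering generated by
    the [h_i] have the same leading components as the elements
    [q_a ^ 2 * prod f_i] of the module, where [a] is the degree of [q].  By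
    stability these never cancel, so the preordering contains no nonzero [p]
    together with [- p].  The heart of the proof is that then some real point
    makes all [h_i] positive ([exists_positive_point], the form of the Artin-Lang
    theorem needed here).  At such a point the rescaled [f_i] stay nonnegative
    for all small [mu], uniformly near the point, and that is a tentacle
    ([tentacle_of_positive_point]).

    The Artin-Lang argument has two halves.  The first realizes the preordering
    as positive elements of a real closed field [L] that contains the
    polynomial ring.  Inside a field with enough roots, here an ultrapower of
    the complex numbers along an ultrafilter of generic points, Zorn's lemma
    gives a maximal cone; the differences of its elements form an ordered field
    in which the intermediate value theorem holds, since a missing root could be
    adjoined and the cone enlarged ([maximal_cone_ivt]).  In [L] the variables
    themselves are a point at which all [h_i] are positive.  The second half
    moves this point down to the reals, one variable at a time: by Tarski
    queries, whether a system of strict inequalities in one variable is solvable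
    in a real closed field depends only on the signs of finitely many elements
    of the coefficient ring ([same_signs_exists_gt0]), and by induction these
    signs can be realized at a real point ([exists_real_point]). *)

Set Implicit Arguments.
Unset Strict Implicit.
Unset Printing Implicit Defensive.

(** * Solvability of polynomial inequalities in one variable *)

Section Specialization.
Import Pdiv.Ring Pdiv.CommonRing Pdiv.RingComRreg.
Variable A : idomainType.
Implicit Types (p q : {poly A}) (G : seq A).

(** A signed remainder sequence computed over [A] stays the right one after a
    specialization [phi] as soon as the leading coefficients met on the way do
    not vanish under [phi]; [generic] keeps track of these finitely many
    conditions. *)
Definition generic (Q : forall F : rcfType, {rmorphism A -> F} -> Prop) :=
  exists2 G : seq A, 0 \notin G &
    forall (F : rcfType) (phi : {rmorphism A -> F}),
      {in G, forall g, phi g != 0} -> Q F phi.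

Lemma genericT (Q : forall F : rcfType, {rmorphism A -> F} -> Prop) :
  (forall F phi, Q F phi) -> generic Q.
Proof. by move=> HQ; exists [::]. Qed.

Lemma genericI (Q1 Q2 Q : forall F : rcfType, {rmorphism A -> F} -> Prop) :
  generic Q1 -> generic Q2 ->
  (forall F phi, Q1 F phi -> Q2 F phi -> Q F phi) -> generic Q.
Proof.
move=> [G1 G10 Q1G] [G2 G20 Q2G] HQ; exists (G1 ++ G2).
  by rewrite mem_cat negb_or G10.
move=> F phi HG; apply: HQ; [apply: Q1G|apply: Q2G] => g gG; apply: HG;
  by rewrite mem_cat gG ?orbT.
Qed.

Lemma generic_neq0 a : a != 0 -> generic (fun F phi => phi a != 0).
Proof.
move=> a0; exists [:: a]; first by rewrite inE eq_sym.
by move=> F phi; apply; rewrite mem_head.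
Qed.

Lemma lead_coef_map_neq0 (F : rcfType) (phi : {rmorphism A -> F}) p :
  phi (lead_coef p) != 0 ->
  size (map_poly phi p) = size p /\
  lead_coef (map_poly phi p) = phi (lead_coef p).
Proof. by move=> p0; rewrite size_map_poly_id0 // lead_coef_map_eq. Qed.

Lemma generic_lead p :
  generic (fun F phi => size (map_poly phi p) = size p /\
                        lead_coef (map_poly phi p) = phi (lead_coef p)).
Proof.
have [->|p0] := eqVneq p 0.
  apply: genericT => F phi.
  by split; rewrite rmorph0 ?size_poly0 // !lead_coef0 rmorph0.
rewrite -lead_coef_eq0 in p0; have gp := generic_neq0 p0.
by apply: (genericI gp gp) => F phi ph _; exact: lead_coef_map_neq0.
Qed.

Lemma map_poly_scale (F : rcfType) (phi : {rmorphism A -> F}) a p :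
  map_poly phi (a *: p) = phi a *: map_poly phi p.
Proof. by rewrite -!mul_polyC rmorphM /= map_polyC. Qed.

Definition map_redivp (F : rcfType) (phi : {rmorphism A -> F})
    (t : nat * {poly A} * {poly A}) :=
  (t.1.1, map_poly phi t.1.2, map_poly phi t.2).

(** Pseudo-division branches on the sizes of the successive remainders, so the
    leading coefficient of each of them has to survive. *)
Lemma generic_redivp_rec n q k qq r :
  generic (fun F phi =>
    redivp_rec (map_poly phi q) k (map_poly phi qq) (map_poly phi r) n =
    map_redivp phi (redivp_rec q k qq r n)).
Proof.
elim: n k qq r => [|n IH] k qq r /=.
  apply: (genericI (generic_lead q) (generic_lead r)) => F phi [-> ->] [-> ->].
  case: ifP => // _; rewrite /map_redivp /=.
  rewrite rmorphD rmorphB /= !rmorphM /= !map_poly_scale /=.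
  by rewrite !map_polyC map_polyXn.
have [rq|rq] := boolP (size r < size q)%N.
  apply: (genericI (generic_lead q) (generic_lead r)) => F phi [-> ->] [-> ->].
  by rewrite rq.
set m := lead_coef r *: 'X^(size r - size q).
have IH' := IH k.+1 (qq * (lead_coef q)%:P + m) (r * (lead_coef q)%:P - m * q).
apply: (genericI (genericI (generic_lead q) (generic_lead r)
  (fun F phi h1 h2 => conj h1 h2)) IH') => F phi [[-> ->] [-> ->]] <-.
rewrite (negbTE rq).
congr (redivp_rec _ _ _ _ _).
  by rewrite rmorphD rmorphM /= map_poly_scale map_polyC map_polyXn.
by rewrite rmorphB !rmorphM /= map_poly_scale map_polyC map_polyXn.
Qed.

(** The function [next_mod], over a ring that need not be a field. *)
Definition pseudo_next p q := - (lead_coef q ^+ rscalp p q) *: rmodp p q.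

Lemma generic_next_mod p q : q != 0 ->
  generic (fun F phi =>
    next_mod (map_poly phi p) (map_poly phi q) =
    map_poly phi (pseudo_next p q)).
Proof.
move=> q0.
apply: (genericI (genericI (generic_lead q) (generic_lead p)
  (fun F phi h1 h2 => conj h1 h2)) (generic_redivp_rec (size p) q 0 0 p)).
move=> F phi [[szq lq] [szp lp]] E.
have q0' : map_poly phi q != 0 by rewrite -size_poly_gt0 szq size_poly_gt0.
have rE (B : nzRingType) (u v : {poly B}) :
    v != 0 -> redivp u v = redivp_rec v 0 0 u (size u).
  by rewrite unlock /redivp_expanded_def => /negbTE ->.
rewrite /next_mod /pseudo_next /rscalp /rmodp !rE // szp.
move: E; rewrite rmorph0 => ->; case: (redivp_rec _ _ _ _) => [[k u] v] /=.
by rewrite lq map_poly_scale /= rmorphN rmorphXn.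
Qed.

Lemma generic_mods p q : exists ms : seq {poly A},
  generic (fun F phi =>
    mods (map_poly phi p) (map_poly phi q) = map (map_poly phi) ms).
Proof.
have [m] := ubnP (size q); elim: m p q => // m IH p q szq.
have [->|p0] := eqVneq p 0.
  by exists [::]; apply: genericT => F phi; rewrite rmorph0 mods0p.
have gp : generic (fun F phi => map_poly phi p != 0).
  have g := generic_lead p; apply: (genericI g g) => F phi [sz _] _.
  by rewrite -size_poly_gt0 sz size_poly_gt0.
have [->|q0] := eqVneq q 0.
  exists [:: p]; apply: (genericI gp gp) => F phi ph _.
  by rewrite rmorph0 modsp0 (negbTE ph).
have [|ms Hms] := IH q (pseudo_next p q).
  apply: (leq_ltn_trans (size_scale_leq _ _)).
  by rewrite (leq_trans (ltn_rmodpN0 p q0)) // -ltnS.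
exists (p :: ms).
apply: (genericI (genericI gp (generic_next_mod p q0)
  (fun F phi h1 h2 => conj h1 h2)) Hms) => F phi [ph E] E'.
by rewrite neq0_mods_rec // E E'.
Qed.

Lemma changes_sgz (F1 F2 : rcfType) (s1 : seq F1) (s2 : seq F2) :
  [seq sgz x | x <- s1] = [seq sgz x | x <- s2] -> changes s1 = changes s2.
Proof.
elim: s1 s2 => [|a1 s1 IH] [|a2 s2] //= [Ea Es].
congr (_ + _)%N; last exact: IH.
have {Es} : sgz (head 0 s1) = sgz (head 0 s2).
  by case: s1 s2 {IH} Es => [|b1 s1] [|b2 s2] //=; rewrite ?sgz0 // => -[].
by move=> E; rewrite -[a1 * _ < 0]sgz_lt0 -[a2 * _ < 0]sgz_lt0 !sgzM Ea E.
Qed.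

Definition same_signs G (F1 F2 : rcfType) (phi1 : {rmorphism A -> F1})
    (phi2 : {rmorphism A -> F2}) :=
  {in G, forall g, sgz (phi1 g) = sgz (phi2 g) /\ phi1 g != 0}.

Lemma same_signsl G1 G2 (F1 F2 : rcfType) (phi1 : {rmorphism A -> F1})
    (phi2 : {rmorphism A -> F2}) :
  same_signs (G1 ++ G2) phi1 phi2 -> same_signs G1 phi1 phi2.
Proof. by move=> HS g gG; apply: HS; rewrite mem_cat gG. Qed.

Lemma same_signsr G1 G2 (F1 F2 : rcfType) (phi1 : {rmorphism A -> F1})
    (phi2 : {rmorphism A -> F2}) :
  same_signs (G1 ++ G2) phi1 phi2 -> same_signs G2 phi1 phi2.
Proof. by move=> HS g gG; apply: HS; rewrite mem_cat gG orbT. Qed.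

Definition lead_coefs (ms : seq {poly A}) :=
  [seq lead_coef m | m <- ms & m != 0].

Lemma lead_coefs_neq0 ms : 0 \notin lead_coefs ms.
Proof.
apply/mapP => -[m]; rewrite mem_filter => /andP[m0 _] /esym/eqP.
by rewrite lead_coef_eq0 (negbTE m0).
Qed.

Lemma same_signs_lead ms (F1 F2 : rcfType) (phi1 : {rmorphism A -> F1})
    (phi2 : {rmorphism A -> F2}) m :
  same_signs (lead_coefs ms) phi1 phi2 -> m \in ms ->
  size (map_poly phi1 m) = size (map_poly phi2 m) /\
  sgz (lead_coef (map_poly phi1 m)) = sgz (lead_coef (map_poly phi2 m)).
Proof.
move=> HS mms; have [->|m0] := eqVneq m 0.
  by rewrite !rmorph0 !size_poly0 !lead_coef0 !sgz0.
have [|E ph1] := HS (lead_coef m); first by rewrite map_f // mem_filter m0.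
have ph2 : phi2 (lead_coef m) != 0 by rewrite -sgz_eq0 -E sgz_eq0.
have [-> ->] := lead_coef_map_neq0 ph1.
by have [-> ->] := lead_coef_map_neq0 ph2.
Qed.

(** A Tarski query reads only the signs of the leading coefficients along a
    signed remainder sequence. *)
Lemma same_signs_taqR p q : exists2 G : seq A, 0 \notin G &
  forall (F1 F2 : rcfType) (phi1 : {rmorphism A -> F1})
    (phi2 : {rmorphism A -> F2}), same_signs G phi1 phi2 ->
  taqR (map_poly phi1 p) (map_poly phi1 q) =
  taqR (map_poly phi2 p) (map_poly phi2 q).
Proof.
have [ms [G G0 HG]] := generic_mods p (p^`() * q).
exists (G ++ lead_coefs ms).
  by rewrite mem_cat negb_or G0 lead_coefs_neq0.
move=> F1 F2 phi1 phi2 HS.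
have HS1 : {in G, forall g, phi1 g != 0}.
  by move=> g /(same_signsl HS)[].
have HS2 : {in G, forall g, phi2 g != 0}.
  by move=> g /(same_signsl HS)[E]; rewrite -sgz_eq0 E sgz_eq0.
rewrite /taqR !deriv_map -!rmorphM /changes_mods HG // HG //.
have lead := same_signs_lead (same_signsr HS).
rewrite /changes_poly /changes_minfty /changes_pinfty -!map_comp.
congr (_%:Z - _%:Z); apply: changes_sgz; rewrite -!map_comp;
  apply/eq_in_map => m /lead /= [Es El]; last exact: El.
by rewrite !sgzM Es El; case: (odd _); rewrite /= ?expr0 ?expr1 ?sgzN ?sgz1.
Qed.

Lemma coefs_ratr (F : rcfType) n i : coefs F n i = ratr (coefs rat n i).
Proof.
rewrite /coefs; have [ni|ni] := leqP (3 ^ n)%N i.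
  rewrite !nth_default ?size_map -?enumT ?size_enum_ord //.
  by rewrite (rmorph0 (@ratr F)).
have o : 'I_(3 ^ n)%N by rewrite exp3n; exact: ord0.
rewrite !(nth_map o) -?enumT ?size_enum_ord // !castmxE /=.
have -> : map_mx intr (ctmat n) =
    map_mx ratr (map_mx intr (ctmat n)) :> 'M[F]_(3 ^ n)%N.
  by rewrite -map_mx_comp; apply/matrixP => a b; rewrite !mxE /= ratr_int.
by rewrite -map_invmx mxE.
Qed.

(** The number of roots of [p] at which all of [sq] are positive is a combination
    of Tarski queries, with rational coefficients that do not depend on the
    field. *)
Lemma ccount_weakE (F : rcfType) (p : {poly F}) (sq : seq {poly F}) :
  ccount_weak p sq = ratr (\sum_(0 <= i < 3 ^ size sq)
    (taqR p (poly_comb sq (nth [::] (sg_tab (size sq)) i)))%:~R *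
    coefs rat (size sq) i).
Proof.
rewrite /ccount_weak; set aux := fix aux s i := if i is _.+1 then _ else _.
have auxE k u : (k <= 3 ^ size sq)%N ->
    aux u k = u + ratr (\sum_(0 <= i < k)
      (taqR p (poly_comb sq (nth [::] (sg_tab (size sq)) i)))%:~R *
      coefs rat (size sq) i).
  elim: k u => [|k IH] u /= k3.
    by rewrite big_geq // (rmorph0 (@ratr F)) addr0.
  rewrite IH ?(ltnW k3) // big_nat_recr //= rmorphD rmorphM /= ratr_int.
  rewrite -coefs_ratr /taqsR (nth_map [::]) ?size_sg_tab //.
  by ring.
by rewrite auxE // add0r.
Qed.

(** One step of quantifier elimination: a family of strict inequalities in one
    variable is solvable for both specializations of its coefficients or for
    neither, once finitely many elements of the coefficient ring have the same
    signs under both. *)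
Lemma same_signs_exists_gt0 (gs : seq {poly A}) :
  exists2 G : seq A, 0 \notin G &
  forall (F1 F2 : rcfType) (phi1 : {rmorphism A -> F1})
    (phi2 : {rmorphism A -> F2}), same_signs G phi1 phi2 ->
  (exists x, all (fun q => 0 < (map_poly phi1 q).[x]) gs) ->
  exists x, all (fun q => 0 < (map_poly phi2 q).[x]) gs.
Proof.
pose comb sc : {poly A} :=
  \prod_(i < size gs) gs`_i ^+ comb_exp (nth 0 sc i : int).
pose tab i := nth [::] (sg_tab (size gs)) i.
pose bp := (\prod_(q <- gs) q)^`().
have [G G0 HG] : exists2 G : seq A, 0 \notin G &
    forall (F1 F2 : rcfType) (phi1 : {rmorphism A -> F1})
      (phi2 : {rmorphism A -> F2}), same_signs G phi1 phi2 ->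
    forall i, (i < 3 ^ size gs)%N ->
    taqR (map_poly phi1 bp) (map_poly phi1 (comb (tab i))) =
    taqR (map_poly phi2 bp) (map_poly phi2 (comb (tab i))).
  elim: (3 ^ size gs)%N => [|k [G1 G10 HG1]]; first by exists [::].
  have [G2 G20 HG2] := same_signs_taqR bp (comb (tab k)).
  exists (G1 ++ G2); first by rewrite mem_cat negb_or G10.
  move=> F1 F2 phi1 phi2 HS i; rewrite ltnS leq_eqVlt => /orP[/eqP->|ik].
    by apply: HG2; exact: same_signsr HS.
  by apply: HG1 => //; exact: same_signsl HS.
exists (G ++ lead_coefs gs).
  by rewrite mem_cat negb_or G0 lead_coefs_neq0.
move=> F1 F2 phi1 phi2 HS; have {}HG := HG _ _ _ _ (same_signsl HS).
have lead := same_signs_lead (same_signsr HS).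
have bpE (F : rcfType) (phi : {rmorphism A -> F}) :
    bounding_poly (map (map_poly phi) gs) = map_poly phi bp.
  by rewrite /bounding_poly big_map -rmorph_prod deriv_map.
have combE (F : rcfType) (phi : {rmorphism A -> F}) sc :
    poly_comb (map (map_poly phi) gs) sc = map_poly phi (comb sc).
  rewrite /poly_comb /comb rmorph_prod size_map; apply: eq_bigr => i _.
  by rewrite (nth_map 0) ?ltn_ord // rmorphXn.
have gt0P (F : rcfType) (phi : {rmorphism A -> F}) :
    reflect (exists x, all (fun q => 0 < (map_poly phi q).[x]) gs)
            (ccount_gt0 [::] (map (map_poly phi) gs)).
  by apply: (iffP (ccount_gt0P _ _)) => -[x] H; exists x; move: H;
    rewrite big_nil big_map big_all.
move=> /gt0P H1; apply/gt0P; move: H1; rewrite /ccount_gt0 !big_nil !eqxx /=.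
rewrite !big_map !big_all !bpE !ccount_weakE !size_map !ltr0q.
have -> : all (fun q => 0 < lead_coef (map_poly phi1 q)) gs =
          all (fun q => 0 < lead_coef (map_poly phi2 q)) gs.
  by apply: eq_in_all => q /lead[_ E]; rewrite -[LHS]sgz_gt0 E sgz_gt0.
have -> : all (fun q => 0 < (-1) ^+ (size (map_poly phi1 q)).-1 *
                            lead_coef (map_poly phi1 q)) gs =
          all (fun q => 0 < (-1) ^+ (size (map_poly phi2 q)).-1 *
                            lead_coef (map_poly phi2 q)) gs.
  apply: eq_in_all => q /lead[-> E].
  rewrite -[LHS]sgz_gt0 sgzM E -[RHS]sgz_gt0 sgzM -signr_odd -[in RHS]signr_odd.
  by case: (odd _); rewrite ?expr0 ?expr1 ?sgzN ?sgz1.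
set c1 := \sum_(0 <= i < _) _; set c2 := \sum_(0 <= i < _) _.
suff -> : c1 = c2 by [].
rewrite /c1 /c2 !big_mkord; apply: eq_bigr => i _.
by rewrite !combE HG.
Qed.

End Specialization.

(** * Descent of a point from a real closed field to the reals *)

Local Notation widen := (widen_ord (leqnSn _)).

Lemma mmap_muni n (R S : comNzRingType) (f : {rmorphism R -> S})
    (t : 'I_n.+1 -> S) (p : mpoly n.+1 R) :
  mmap f t p = (map_poly (mmap f (t \o widen)) (muni p)).[t ord_max].
Proof.
rewrite muniE rmorph_sum /= horner_sum [LHS]/mmap; apply: eq_bigr => m _.
rewrite -mul_polyC rmorphM /= map_polyXn map_polyC /= hornerM hornerXn hornerC.
rewrite mmapZ mmapX -mulrA; congr (_ * _).
rewrite /mmap1 big_ord_recr /=; congr (_ * _).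
by apply: eq_bigr => i _; rewrite mnmE.
Qed.

Lemma mmap_mwiden n (R S : comNzRingType) (f : {rmorphism R -> S})
    (t : 'I_n.+1 -> S) (p : mpoly n R) :
  mmap f t (mwiden p) = mmap f (t \o widen) p.
Proof.
rewrite {1}[p]mpolyE (raddf_sum (@mwiden n R)) raddf_sum /= [RHS]/mmap.
apply: eq_bigr => m _.
rewrite mwidenZ mmapZ mwidenX mmapX; congr (_ * _).
rewrite /mmap1 big_ord_recr /= mnmwiden_ordmax expr0 mulr1.
by apply: eq_bigr => i _; rewrite mnmwiden_widen.
Qed.

Lemma muni_eq0 n (R : comNzRingType) (p : mpoly n.+1 R) : muni p = 0 -> p = 0.
Proof.
move=> p0; have := mmap_muni (@mpolyC n.+1 R) (fun i => mpolyX R (mnm1 i)) p.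
rewrite p0 rmorph0 horner0 => <-.
by rewrite {1}[p]mpolyE; apply: eq_bigr => m _; rewrite mmap1_id -mul_mpolyC.
Qed.

Lemma widen_lift n (i : 'I_n) : widen i = lift ord_max i.
Proof. by apply: val_inj; rewrite /= /bump leqNgt ltn_ord. Qed.

(** A constant polynomial in no variables is positive in [L] only if it is
    positive in [R], because nonnegative elements of [R] are squares; the last
    variable is then eliminated with [same_signs_exists_gt0], over the ring of
    polynomials in the other variables.  Algebraic independence of [t] makes the
    finitely many sign conditions strict, so that the induction hypothesis
    applies to them. *)
Lemma exists_real_point n (R L : rcfType) (f : {rmorphism R -> L})
    (t : 'I_n -> L) (ps : seq (mpoly n R)) :
  (forall p, p != 0 -> mmap f t p != 0) ->
  all (fun p => 0 < mmap f t p) ps ->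
  exists y : 'I_n -> R, all (fun p => 0 < meval y p) ps.
Proof.
elim: n t ps => [|n IH] t ps t_free ps_gt0.
  exists (fun _ => 0); apply/allP => p /(allP ps_gt0).
  have -> : p = mpolyC 0 (mcoeff mnm0 p).
    apply/mpolyP => m; have -> : m = mnm0 by apply/mnmP => -[].
    by rewrite mcoeffC eqxx mulr1.
  rewrite mmapC mevalC; case: (ltrgtP 0 (mcoeff mnm0 p)) => // [c0|<-].
    have Nc : - mcoeff mnm0 p = Num.sqrt (- mcoeff mnm0 p) ^+ 2.
      by rewrite sqr_sqrtr // oppr_ge0 ltW.
    by rewrite ltNge -oppr_ge0 -(rmorphN f) Nc rmorphXn sqr_ge0.
  by rewrite raddf0 ltxx.
pose t' := t \o widen.
have t'_free p : p != 0 -> mmap f t' p != 0.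
  move=> p0; rewrite /t' -mmap_mwiden; apply: t_free.
  by rewrite -(mwiden0 n R) (inj_eq (@inj_mwiden _ _)).
pose gs := [seq muni p | p <- ps].
have [G G0 HG] := same_signs_exists_gt0 gs.
pose Gs := [seq (if 0 < mmap f t' g then g else - g) | g <- G].
have [|y /allP Hy] := IH t' Gs t'_free.
  apply/allP => _ /mapP[g gG ->]; case: ifPn => // g0.
  rewrite rmorphN oppr_gt0 lt_neqAle t'_free ?leNgt //.
  by apply: contraNneq G0 => <-.
have [||x Hx] := HG L R (mmap f t') (mmap idfun y).
- move=> g gG; have g0 : g != 0 by apply: contraNneq G0 => <-.
  split; last exact: t'_free.
  change (sgz (mmap f t' g) = sgz (meval y g)); have := Hy _ (map_f _ gG).
  case: ifPn => [fg yg|fg]; first by rewrite !gtr0_sgz.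
  rewrite mevalN oppr_gt0 => yg; rewrite !ltr0_sgz //.
  by rewrite lt_neqAle t'_free ?leNgt.
- exists (t ord_max); rewrite all_map; apply/allP => p /(allP ps_gt0) /=.
  by rewrite mmap_muni.
exists (fun i => if unlift ord_max i is Some j then y j else x).
apply/allP => p pps; have := allP Hx _ (map_f _ pps).
rewrite /meval [in X in _ -> X]mmap_muni unlift_none.
congr (0 < _.[_]); apply: eq_map_poly => q; apply: meval_eq => i /=.
by rewrite widen_lift liftK.
Qed.

Lemma exists_meval_neq0_near n (R : numFieldType) (p : mpoly n R)
    (x r : 'I_n -> R) : (forall i, 0 < r i) -> p != 0 ->
  exists2 y : 'I_n -> R, forall i, `|y i - x i| < r i & meval y p != 0.
Proof.
elim: n p x r => [|n IH] p x r r0 p0.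
  exists (fun _ => 0); first by case.
  have pE : p = mpolyC 0 (mcoeff mnm0 p).
    apply/mpolyP => m; have -> : m = mnm0 by apply/mnmP => -[].
    by rewrite mcoeffC eqxx mulr1.
  by rewrite pE mevalC; apply: contraNneq p0 => p00; rewrite pE p00 mpolyC0.
have m0 : muni p != 0 by apply: contraNneq p0 => /muni_eq0 ->.
have [|y yx py] :=
    IH (lead_coef (muni p)) (x \o widen) (r \o widen) (fun=> r0 _).
  by rewrite lead_coef_eq0.
pose q := map_poly (meval y) (muni p).
have q0 : q != 0 by rewrite -lead_coef_eq0 lead_coef_map_eq.
(* More candidates than roots, all within the allowed distance. *)
pose us := [seq x ord_max + r ord_max / k.+2%:R | k <- iota 0 (size q)].
have us_uniq : uniq us.
  rewrite map_inj_uniq ?iota_uniq // => i j.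
  move=> /addrI /(mulfI (lt0r_neq0 (r0 _))) /invr_inj.
  by move/eqP; rewrite eqr_nat => /eqP [].
have [u uus qu] : exists2 u, u \in us & q.[u] != 0.
  apply/hasP; apply: contraT; rewrite -all_predC => /allP roots_us.
  have : all (root q) us by apply/allP => u /roots_us /=; rewrite negbK.
  by move/(max_poly_roots q0)/(_ us_uniq); rewrite size_map size_iota ltnn.
exists (fun i => if unlift ord_max i is Some j then y j else u).
  move=> i; case: unliftP => [j|] ->.
    by rewrite -widen_lift; exact: yx.
  case/mapP: uus => k _ ->; rewrite addrC addKr ger0_norm ?divr_ge0 ?ltW //.
  by rewrite ltr_pdivrMr // ltr_pMr // ltr1n.
rewrite /meval mmap_muni unlift_none.
set q' := map_poly _ _; suff -> : q' = q by [].
apply: eq_map_poly => g; apply: meval_eq => i /=.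
by rewrite widen_lift liftK.
Qed.

(** * A field containing the polynomials and having enough roots *)

(** Bundled, so that the field structure of the ultrapower below can be found
    from the filter alone. *)
Record ultrafilter (I : Type) := Ultrafilter {
  ultra_system :> set_system I;
  ultra_systemP : UltraFilter ultra_system }.

Section Ultrapower.
Local Open Scope quotient_scope.
Variables (I : pointedType) (U : ultrafilter I) (C : closedFieldType).

#[local] Instance ultrafilter_proper : ProperFilter (ultra_system U) :=
  @ultra_proper _ _ (ultra_systemP U).

Definition almost_null (f : I -> C) := `[< ultra_system U [set i | f i = 0] >].

Lemma almost_null_idealr : idealr_closed almost_null.
Proof.
split.
- by apply/asboolP; apply: filterS filterT => i.
- apply/asboolP => H; have /filter_ex[i /eqP] := H.
  by rewrite oner_eq0.
- move=> a u v /asboolP u0 /asboolP v0; apply/asboolP.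
  apply: filterS2 u0 v0 => i /= ui vi; change (a i * u i + v i = 0).
  by rewrite ui vi mulr0 addr0.
Qed.

HB.instance Definition _ :=
  isIdealr.Build (I -> C) almost_null almost_null_idealr.

Definition null_ideal := Idealr.clone (I -> C) almost_null _.

Definition ultrapower := {ideal_quot null_ideal}.
HB.instance Definition _ := GRing.ComNzRing.on ultrapower.
HB.instance Definition _ := EqQuotient.on ultrapower.

Lemma ultrapower_eq (f g : I -> C) :
  \pi_ultrapower f = \pi_ultrapower g <-> ultra_system U [set i | f i = g i].
Proof.
have E : (\pi_ultrapower f == \pi_ultrapower g) = almost_null (f - g).
  exact: esym (Quotient.idealrBE null_ideal f g).
split=> [/eqP|H]; last apply/eqP; rewrite E.
  move=> /asboolP; apply: filterS => i /=; rewrite -[(f - g) i]/(f i - g i).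
  by move=> /eqP; rewrite subr_eq0 => /eqP.
apply/asboolP; move: H; apply: filterS => i /= fg.
by rewrite -[(f - g) i]/(f i - g i) fg subrr.
Qed.

Lemma ultrapower_mulVf (x : ultrapower) :
  x != 0 -> \pi_ultrapower (fun i => (repr x i)^-1) * x = 1.
Proof.
rewrite -{1 3}[x]reprK => x0.
rewrite -[LHS](rmorphM \pi_ultrapower) -(rmorph1 \pi_ultrapower).
apply/ultrapower_eq; have [x_null|] := in_ultra_setVsetC
    [set i | repr x i = 0] (ultra_systemP U).
  case/eqP: x0; rewrite -(rmorph0 \pi_ultrapower).
  by apply/ultrapower_eq.
apply: filterS => i /= /eqP xi.
by rewrite -[LHS]/((repr x i)^-1 * repr x i) mulVf.
Qed.

Lemma ultrapower_inv0 :
  \pi_ultrapower (fun i => (repr (0 : ultrapower) i)^-1) = 0.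
Proof.
have : \pi_ultrapower (repr (0 : ultrapower)) = \pi_ultrapower 0.
  by rewrite reprK rmorph0.
rewrite -(rmorph0 \pi_ultrapower); set z := repr _ => /ultrapower_eq z0.
apply/ultrapower_eq; move: z0; apply: filterS => i /= ->.
by rewrite -[RHS]/(0 : C) -[0 i]/(0 : C) invr0.
Qed.

HB.instance Definition _ := GRing.ComNzRing_isField.Build ultrapower
  ultrapower_mulVf ultrapower_inv0.

(** The roots are chosen pointwise. *)
Lemma ultrapower_root (p : {poly ultrapower}) :
  (1 < size p)%N -> exists x, root p x.
Proof.
move=> szp; pose c k := repr p`_k.
pose P i := \poly_(k < size p) c k i : {poly C}.
pose x i := xget 0 [set r | root (P i) r].
exists (\pi_ultrapower x); rewrite /root horner_coef.
have -> : \sum_(k < size p) p`_k * \pi_ultrapower x ^+ k =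
    \pi_ultrapower (\sum_(k < size p) c k * x ^+ k).
  rewrite rmorph_sum; apply: eq_bigr => k _.
  by rewrite rmorphM rmorphXn /= reprK.
apply/eqP; rewrite -(rmorph0 \pi_ultrapower); apply/ultrapower_eq.
have lead0 : p`_(size p).-1 != 0.
  by rewrite -/(lead_coef p) lead_coef_eq0 -size_poly_gt0 (ltn_trans _ szp).
have [c_null|] := in_ultra_setVsetC
    [set i | c (size p).-1 i = 0] (ultra_systemP U).
  case/eqP: lead0; rewrite -[LHS]reprK -[RHS](rmorph0 \pi_ultrapower).
  by apply/ultrapower_eq.
apply: filterS => i /= /eqP ci.
have szP : size (P i) = size p by rewrite size_poly_eq.
have : root (P i) (x i).
  apply: (@xgetPex _ 0 [set r | root (P i) r]); apply/closed_rootP.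
  by rewrite szP gtn_eqF.
rewrite /root horner_coef szP => /eqP; rewrite fct_sumE => E; rewrite -[RHS]E.
apply: eq_bigr => k _; rewrite coef_poly ltn_ord.
rewrite -[LHS]/(c k i * (x ^+ k) i); congr (_ * _).
by elim: (nat_of_ord k) => // j IH; rewrite !exprS -[LHS]/(x i * (x ^+ j) i) IH.
Qed.

End Ultrapower.

Section GenericPoint.
Local Open Scope quotient_scope.
Variables (R : realType) (n : nat).

(** An ultrafilter finer than this one picks generic points: no nonzero
    polynomial vanishes on any of its sets. *)
Definition off_hypersurface : set_system ('I_n -> R) :=
  [set S | exists2 p : mpoly n R, p != 0 & [set y | meval y p != 0] `<=` S].

Lemma off_hypersurface_proper : ProperFilter off_hypersurface.
Proof.
split.
  case=> p p0 /= H.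
  by have [y _ /H[]] := exists_meval_neq0_near (fun=> 0) (fun=> ltr01) p0.
split.
- by exists 1 => //; exact: oner_neq0.
- move=> S T [p p0 pS] [q q0 qT]; exists (p * q); first exact: mulf_neq0.
  by move=> y /=; rewrite mevalM mulf_eq0 negb_or => /andP[/pS ? /qT].
- by move=> S T ST [p p0 pS]; exists p => //; exact: subset_trans ST.
Qed.

Definition eval_fun (p : mpoly n R) : ('I_n -> R) -> complex R :=
  fun y => real_complex R (meval y p).

Lemma eval_fun_zmod : zmod_morphism eval_fun.
Proof. by move=> p q; apply/funext => y; rewrite /eval_fun mevalB rmorphB. Qed.

Lemma eval_fun_monoid : monoid_morphism eval_fun.
Proof.
split; first by apply/funext => y; rewrite /eval_fun meval1 rmorph1.
by move=> p q; apply/funext => y; rewrite /eval_fun mevalM rmorphM.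
Qed.

HB.instance Definition _ := GRing.isZmodMorphism.Build (mpoly n R)
  (('I_n -> R) -> complex R) eval_fun eval_fun_zmod.
HB.instance Definition _ := GRing.isMonoidMorphism.Build (mpoly n R)
  (('I_n -> R) -> complex R) eval_fun eval_fun_monoid.

(** Evaluating polynomials at all points of [R ^ n] embeds them in the
    ultrapower of the complex numbers along an ultrafilter of generic points. *)
Lemma exists_root_closed_field : exists (K : fieldType)
    (f : {rmorphism mpoly n R -> K}),
  (forall p, p != 0 -> f p != 0) /\
  (forall p : {poly K}, (1 < size p)%N -> exists x, root p x).
Proof.
have [G [GU FG]] := ultraFilterLemma off_hypersurface_proper.
pose U : ultrafilter ('I_n -> R : pointedType) := Ultrafilter GU.
pose K := ultrapower U (complex R : closedFieldType).
pose f : {rmorphism mpoly n R -> K} := \pi_K \o eval_fun.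
exists K, f; split; last exact: ultrapower_root.
move=> p p0; apply/eqP => fp0.
have : \pi_K (eval_fun p) = \pi_K 0 by rewrite rmorph0.
move=> /ultrapower_eq pG0; have GP : ProperFilter G := ultra_proper.
have pG1 : G [set y | meval y p != 0] by apply: FG; exists p.
have /filter_ex[y [/= yp0 /eqP yp]] : G ([set y | eval_fun p y = 0] `&`
  [set y | meval y p != 0]) by exact: filterI.
by apply: yp; apply: (@complexI R); rewrite rmorph0.
Qed.

End GenericPoint.

(** * The real closed field of a maximal cone *)

(** The positive cone of an ordering of the subfield of differences [x - y] of
    its elements, except that it need not be total. *)
Record is_cone (K : fieldType) (Q : set K) : Prop := IsCone {
  cone1 : Q 1;
  coneD : forall x y, Q x -> Q y -> Q (x + y);
  coneM : forall x y, Q x -> Q y -> Q (x * y);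
  coneV : forall x, Q x -> Q x^-1;
  coneBX2 : forall x y, Q x -> Q y -> Q ((x - y) ^+ 2);
  coneN1 : ~ Q (- 1) }.

(** An irreducible polynomial [p] that changes sign on [a, b] is given a root
    [theta]; the ordering of [L] then extends to [L(theta)].  The intermediate
    value theorem is assumed for polynomials of smaller size. *)
Section AdjoinRoot.
Variables (L : realFieldType) (K : fieldType) (v : {rmorphism L -> K}).
Variables (p : {poly L}) (a b : L) (theta : K).
Hypothesis ab : a <= b.
Hypothesis pa : p.[a] < 0.
Hypothesis pb : 0 < p.[b].
Hypothesis p_irr : forall u, u %| p -> (1 < size u)%N -> (size p <= size u)%N.
Hypothesis ivt_lt : forall q : {poly L}, (size q < size p)%N ->
  q.[a] <= 0 <= q.[b] -> exists2 x, a <= x <= b & root q x.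
Hypothesis p_theta : root (map_poly v p) theta.

Local Notation ev g := (map_poly v g).[theta].

Lemma adjoined_neq0 : p != 0.
Proof. by apply: contraTneq pb => ->; rewrite horner0 ltxx. Qed.

(** By irreducibility, [p] is the minimal polynomial of [theta]. *)
Lemma ev_eq0 g : ev g = 0 -> p %| g.
Proof.
move=> g0; have d0 : gcdp p g != 0 by rewrite gcdp_eq0 negb_and adjoined_neq0.
have : root (map_poly v (gcdp p g)) theta.
  by rewrite gcdp_map root_gcd p_theta; apply/eqP.
have [/eqP|] := eqVneq (size (gcdp p g)) 1%N.
  move/size_poly1P => [c c0 ->]; rewrite map_polyC rootC /=.
  by rewrite fmorph_eq0 (negbTE c0).
move=> sz1 _; have sz : (1 < size (gcdp p g))%N.
  by rewrite ltn_neqAle eq_sym sz1 size_poly_gt0.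
have /eqP E : size (gcdp p g) == size p.
  by rewrite eqn_leq p_irr ?dvdp_gcdl // dvdp_leq ?adjoined_neq0 ?dvdp_gcdl.
have : gcdp p g %= p by rewrite -dvdp_size_eqp ?dvdp_gcdl // E.
by move=> /eqp_dvdl <-; exact: dvdp_gcdr.
Qed.

Definition adjoin_cone : set K := [set y | exists2 ts : seq (L * {poly L}),
  all (fun t => 0 <= t.1) ts & y = \sum_(t <- ts) v t.1 * ev t.2 ^+ 2].

Lemma adjoin_cone_ev y : adjoin_cone y -> exists g, y = ev g.
Proof.
case=> ts _ ->; exists (\sum_(t <- ts) t.1%:P * t.2 ^+ 2).
rewrite rmorph_sum horner_sum; apply: eq_bigr => t _.
by rewrite rmorphM rmorphXn /= map_polyC hornerM hornerC horner_exp.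
Qed.

Lemma adjoin_coneX2 g : adjoin_cone (ev g ^+ 2).
Proof.
by exists [:: (1, g)]; [rewrite /= ler01 | rewrite big_seq1 /= rmorph1 mul1r].
Qed.

Lemma adjoin_coneM x y : adjoin_cone x -> adjoin_cone y -> adjoin_cone (x * y).
Proof.
move=> [ts ts0 ->] [us us0 ->].
exists [seq (t.1 * u.1, t.2 * u.2) | t <- ts, u <- us].
  apply/allP => _ /allpairsP[[t u] /= [tts uus ->]] /=.
  by apply: mulr_ge0; [exact: (allP ts0) | exact: (allP us0)].
rewrite big_allpairs_dep mulr_suml; apply: eq_bigr => t _.
rewrite mulr_sumr; apply: eq_bigr => u _ /=.
by rewrite !rmorphM /= hornerM exprMn mulrACA.
Qed.

Lemma adjoin_cone_ge0 x : 0 <= x -> adjoin_cone (v x).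
Proof.
move=> x0; exists [:: (x, 1)]; first by rewrite /= x0.
by rewrite big_seq1 /= rmorph1 -polyC1 hornerC expr1n mulr1.
Qed.

(** If [- 1] were a combination of squares with nonnegative coefficients,
    reducing modulo [p] would give [w = h * p] with [w >= 1] on [L] and [h]
    smaller than [p].  As [p] changes sign, so does [h], which then has a root
    in [L], where [w] vanishes. *)
Lemma adjoin_coneN1 : ~ adjoin_cone (- 1).
Proof.
case=> ts ts0 E; pose w := 1 + \sum_(t <- ts) t.1%:P * (t.2 %% p) ^+ 2.
have w_ge1 c : 1 <= w.[c].
  rewrite hornerD hornerC lerDl horner_sum big_seq sumr_ge0 //.
  move=> t /(allP ts0) t0.
  by rewrite hornerM hornerC horner_exp mulr_ge0 ?sqr_ge0.
have w0 : w != 0.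
  by apply: contraTneq (w_ge1 0) => ->; rewrite horner0 -ltNge ltr01.
have /ev_eq0 pw : ev w = 0.
  rewrite rmorphD rmorph1 /= hornerD hornerC rmorph_sum horner_sum.
  apply/eqP; rewrite addrC addr_eq0 E; apply/eqP; apply: eq_bigr => t _.
  rewrite rmorphM rmorphXn /= map_polyC hornerM hornerC horner_exp.
  congr (_ * _ ^+ 2); rewrite {2}(divp_eq t.2 p) rmorphD rmorphM /=.
  by rewrite hornerD hornerM (eqP p_theta) mulr0 add0r.
have szp1 : (1 < size p)%N.
  rewrite ltnNge; apply/negP => /size1_polyC pE; move: pa pb.
  by rewrite pE !hornerC => /lt_trans H /H; rewrite ltxx.
have szw : (size w <= (size p).*2 - 3)%N.
  rewrite (leq_trans (size_polyD _ _)) // geq_max size_poly1; apply/andP; split.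
    by rewrite -addnn; lia.
  apply: (leq_trans (size_sum _ _ _)); apply/bigmax_leqP_seq => t _ _.
  rewrite mul_polyC (leq_trans (size_scale_leq _ _)) //.
  have := ltn_modpN0 t.2 adjoined_neq0; set r := t.2 %% p => szr.
  rewrite expr2 (leq_trans (size_polyMleq _ _)) //.
  by rewrite -addnn; move: szr szp1; move: (size r) (size p) => x y; lia.
have /dvdpP[h wE] := pw.
have h0 : h != 0 by apply: contraNneq w0 => h0; rewrite wE h0 mul0r.
have szh : (size h < size p)%N.
  move: szw; rewrite wE size_mul ?adjoined_neq0 //.
  move: h0 szp1; rewrite -size_poly_gt0 -addnn.
  by move: (size h) (size p) => x y; lia.
have w_gt0 c : 0 < h.[c] * p.[c] by rewrite -hornerM -wE (lt_le_trans ltr01).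
have [c _ hc] : exists2 x, a <= x <= b & root h x.
  apply: ivt_lt => //; move: (w_gt0 a) (w_gt0 b).
  by rewrite (nmulr_lgt0 _ pa) (pmulr_lgt0 _ pb) => /ltW -> /ltW ->.
by have := w_gt0 c; rewrite (eqP hc) mul0r ltxx.
Qed.

(** The inverse of [x] is [x] times the square of its inverse, and the latter is
    a polynomial in [theta]. *)
Lemma adjoin_coneV x : adjoin_cone x -> adjoin_cone x^-1.
Proof.
move=> Qx; have [->|x0] := eqVneq x 0.
  by rewrite invr0 -(rmorph0 v); exact: adjoin_cone_ge0.
suff [g xV] : exists g, x^-1 = ev g.
  have -> : x^-1 = x * ev g ^+ 2 by rewrite -xV expr2 mulVKf.
  exact: adjoin_coneM (adjoin_coneX2 g).
have [g xE] := adjoin_cone_ev Qx.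
have pg : coprimep p g.
  rewrite /coprimep eqn_leq lt0n size_poly_eq0 gcdp_eq0 negb_and adjoined_neq0.
  rewrite andbT leqNgt.
  apply/negP => sz; have sz' := p_irr (dvdp_gcdl _ _) sz.
  case/eqP: x0; rewrite xE.
  have : gcdp p g %= p.
    rewrite -dvdp_size_eqp ?dvdp_gcdl // eqn_leq sz'.
    by rewrite dvdp_leq ?adjoined_neq0 ?dvdp_gcdl.
  move=> /eqp_dvdl E; have : p %| g by rewrite -E dvdp_gcdr.
  case/dvdpP => h ->.
  by rewrite rmorphM hornerM (eqP p_theta) mulr0.
have /Bezout_coprimepP[[u w] /=] := pg.
rewrite -size_poly_eq1 => /size_poly1P[c c0 E].
exists (c^-1%:P * w); apply: (mulIf x0); rewrite mulVf //.
have : ev (u * p + w * g) = v c by rewrite E map_polyC hornerC.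
rewrite rmorphD !rmorphM /= hornerD !hornerM (eqP p_theta) mulr0 add0r -xE.
move=> E'.
by rewrite map_polyC hornerC -mulrA E' -rmorphM mulVf // rmorph1.
Qed.

Lemma adjoin_cone_is_cone : is_cone adjoin_cone.
Proof.
split.
- by rewrite -(rmorph1 v); exact: adjoin_cone_ge0.
- move=> _ _ [ts ts0 ->] [us us0 ->]; exists (ts ++ us).
    by rewrite all_cat ts0.
  by rewrite big_cat.
- exact: adjoin_coneM.
- exact: adjoin_coneV.
- move=> x y /adjoin_cone_ev[g ->] /adjoin_cone_ev[h ->].
  by rewrite -hornerN -hornerD -rmorphN -rmorphD; exact: adjoin_coneX2.
- exact: adjoin_coneN1.
Qed.

(** Since [4 theta = (theta + 1) ^ 2 - (theta - 1) ^ 2]. *)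
Lemma adjoin_cone_theta :
  (forall y, adjoin_cone y -> exists x, v x = y) -> exists x, v x = theta.
Proof.
move=> QE.
have [x xE] := QE _ (adjoin_coneX2 ('X + 1)).
have [y yE] := QE _ (adjoin_coneX2 ('X - 1)).
have four0 : v 4 != 0 by rewrite fmorph_eq0 pnatr_eq0.
exists ((x - y) / 4); rewrite fmorph_div rmorphB xE yE.
apply: (mulIf four0); rewrite divfK // rmorphD rmorphB /= rmorph1 map_polyX.
by rewrite !hornerE rmorph_nat; ring.
Qed.

End AdjoinRoot.

(** A polynomial of least size that changes sign on [a, b] without having a root
    there is irreducible, as one of two factors would change sign as well.  By
    maximality the root adjoined above is already in [L], so the polynomial is
    linear, and a linear polynomial has its root where it changes sign. *)
Lemma maximal_cone_ivt (L : realFieldType) (K : fieldType)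
    (v : {rmorphism L -> K}) :
  (forall p : {poly K}, (1 < size p)%N -> exists x, root p x) ->
  (forall Q, is_cone Q -> (forall x, 0 <= x -> Q (v x)) ->
    forall y, Q y -> exists x, v x = y) ->
  Num.real_closed_axiom L.
Proof.
move=> K_root v_max p a b ab; have [m] := ubnP (size p).
elim: m p => // m IH p szp /andP[pa pb].
have [pa0|pa0] := eqVneq p.[a] 0.
  by exists a; rewrite ?lexx ?ab //; apply/eqP.
have [pb0|pb0] := eqVneq p.[b] 0.
  by exists b; rewrite ?lexx ?ab //; apply/eqP.
have {pa pa0}pa : p.[a] < 0 by rewrite lt_neqAle pa0.
have {pb pb0}pb : 0 < p.[b] by rewrite lt_neqAle eq_sym pb0.
have p0 : p != 0 by apply: contraTneq pb => ->; rewrite horner0 ltxx.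
have ivt_lt (q : {poly L}) : (size q < size p)%N -> q.[a] * q.[b] <= 0 ->
    exists2 x, a <= x <= b & root q x.
  move=> szq qab; have szqm : (size q < m)%N by apply: leq_trans szq _.
  have [qa|qa] := leP q.[a] 0; have [qb|qb] := leP 0 q.[b].
  - by apply: IH => //; rewrite qa.
  - have : q.[a] = 0 by apply/eqP; rewrite eq_le qa -(nmulr_lle0 _ qb).
    by exists a; rewrite ?lexx //; apply/eqP.
  - have : q.[b] = 0 by apply/eqP; rewrite eq_le qb -(pmulr_rle0 _ qa) qab.
    by exists b; rewrite ?lexx ?ab //; apply/eqP.
  - have [||x xab] := IH (- q); rewrite ?size_polyN ?hornerN //.
      by rewrite oppr_le0 oppr_ge0 !ltW.
    by rewrite rootN; exists x.
have [[u [up szu szup]]|p_irr] :=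
    pselect (exists u, [/\ u %| p, (1 < size u)%N & (size u < size p)%N]).
  have [w pE] := dvdpP _ _ up.
  have [u0 w0] : u != 0 /\ w != 0.
    by split; apply: contraNneq p0 => z; rewrite pE z ?mulr0 ?mul0r.
  have szw : (size w < size p)%N.
    rewrite pE size_mul //; move: szu w0; rewrite -size_poly_gt0.
    by move: (size u) (size w) => x y; lia.
  have : (w.[a] * w.[b]) * (u.[a] * u.[b]) <= 0.
    by rewrite mulrACA -!hornerM -pE ltW // nmulr_rlt0.
  have [wab|wab] := leP (w.[a] * w.[b]) 0; last first.
    rewrite pmulr_rle0 // => uab; have [x xab ux] := ivt_lt u szup uab.
    by exists x => //; rewrite pE rootM ux orbT.
  have [x xab wx] := ivt_lt w szw wab.
  by exists x => //; rewrite pE rootM wx.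
have {}p_irr u : u %| p -> (1 < size u)%N -> (size p <= size u)%N.
  by move=> up szu; rewrite leqNgt; apply/negP => szup; case: p_irr; exists u.
have szp1 : (1 < size p)%N.
  rewrite ltnNge; apply/negP => /size1_polyC pE; move: pa pb.
  by rewrite pE !hornerC => /lt_trans H /H; rewrite ltxx.
have [|theta ptheta] := K_root (map_poly v p); first by rewrite size_map_poly.
have ivt_lt' (q : {poly L}) : (size q < size p)%N -> q.[a] <= 0 <= q.[b] ->
    exists2 x, a <= x <= b & root q x.
  by move=> szq /andP[qa qb]; apply: ivt_lt => //; exact: mulr_le0_ge0.
have [x xE] : exists x, v x = theta.
  apply: adjoin_cone_theta; apply: v_max.
    exact: (adjoin_cone_is_cone ab pa pb p_irr ivt_lt' ptheta).
  by move=> y y0; exact: adjoin_cone_ge0.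
have px : root p x by rewrite -xE fmorph_root in ptheta.
exists x => //; have /dvdpP[q pE] : 'X - x%:P %| p by rewrite dvdp_XsubCl.
have q0 : q != 0 by apply: contraNneq p0 => q0; rewrite pE q0 mul0r.
have szq : (size q <= 1)%N.
  have := p_irr ('X - x%:P); rewrite dvdp_XsubCl size_XsubC => /(_ px isT).
  rewrite pE size_Mmonic ?monicXsubC // size_XsubC.
  by move: (size q) => y; lia.
move: pa pb; rewrite pE (size1_polyC szq) !hornerM !hornerC !hornerXsubC.
by nra.
Qed.

Record maximal_cone (K : fieldType) := MaximalCone {
  max_cone :> set K;
  max_cone_is_cone : is_cone max_cone;
  max_cone_max : forall Q, is_cone Q -> max_cone `<=` Q -> Q `<=` max_cone }.

Lemma exists_maximal_cone (K : fieldType) (Q0 : set K) :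
  is_cone Q0 -> exists M : maximal_cone K, Q0 `<=` max_cone M.
Proof.
move=> Q0c; pose P := [set S : set K | S = set0 \/ (Q0 `<=` S /\ is_cone S)].
have [|M [[M0|[Q0M Mc]] Mmax]] := @Zorn_bigcup K P.
- move=> F FP Ftot; have [[S [FS [x Sx]]]|F0] :=
    pselect (exists S, F S /\ S !=set0); last first.
    left; rewrite -subset0 => x [S FS Sx]; apply: F0; exists S; split=> //.
    by exists x.
  have cone_in T y : F T -> T y -> Q0 `<=` T /\ is_cone T.
    by move=> FT Ty; case: (FP _ FT) => // T0; rewrite T0 in Ty.
  have common y z : (\bigcup_(X in F) X) y -> (\bigcup_(X in F) X) z ->
      exists T, [/\ F T, is_cone T, T y & T z].
    move=> [T FT Ty] [T' FT' Tz]; have [_ Tc] := cone_in _ _ FT Ty.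
    have [_ T'c] := cone_in _ _ FT' Tz.
    case: (Ftot _ _ FT FT') => sub; [exists T'|exists T]; split=> //.
      exact: sub.
    exact: sub.
  have [Q0S Sc] := cone_in _ _ FS Sx.
  right; split; first by move=> y Q0y; exists S => //; exact: Q0S.
  split.
  - by exists S => //; exact: (cone1 Sc).
  - move=> y z Fy Fz; have [T [FT Tc Ty Tz]] := common _ _ Fy Fz.
    by exists T => //; exact: (coneD Tc).
  - move=> y z Fy Fz; have [T [FT Tc Ty Tz]] := common _ _ Fy Fz.
    by exists T => //; exact: (coneM Tc).
  - move=> y Fy; have [T [FT Tc Ty _]] := common _ _ Fy Fy.
    by exists T => //; exact: (coneV Tc).
  - move=> y z Fy Fz; have [T [FT Tc Ty Tz]] := common _ _ Fy Fz.
    by exists T => //; exact: (coneBX2 Tc).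
  - by case=> T FT TN1; have [_ Tc] := cone_in _ _ FT TN1; exact: (coneN1 Tc).
- case: (Mmax Q0); last by right; split.
  split; first by rewrite M0; exact: sub0set.
  by move=> Q0M; have := Q0M _ (cone1 Q0c); rewrite M0.
- suff Mmax' Q : is_cone Q -> M `<=` Q -> Q `<=` M.
    by exists (MaximalCone Mc Mmax').
  move=> Qc MQ; apply: contrapT => QM; apply: (Mmax Q); first by split.
  by right; split=> //; exact: subset_trans MQ.
Qed.

Section ConeField.
Variables (K : fieldType) (M : maximal_cone K).
Local Notation P := (max_cone M).
Let Mc := max_cone_is_cone M.

Definition cone_diff (x : K) := `[< exists a b, [/\ P a, P b & x = a - b] >].

Lemma cone0 : P 0.
Proof.
have -> : 0 = (1 - 1) ^+ 2 :> K by rewrite subrr expr0n.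
by apply: (coneBX2 Mc); exact: (cone1 Mc).
Qed.

Lemma cone_diffX2 x : x \in cone_diff -> P (x ^+ 2).
Proof. by move=> /asboolP[a [b [Ma Mb ->]]]; exact: (coneBX2 Mc). Qed.

Lemma cone_diff_cone x : P x -> x \in cone_diff.
Proof.
move=> Mx; apply/asboolP; exists x, 0.
by split; rewrite ?subr0 //; exact: cone0.
Qed.

Lemma cone_diff_divring : divring_closed cone_diff.
Proof.
have diffM x y : x \in cone_diff -> y \in cone_diff -> x * y \in cone_diff.
  move=> /asboolP[a [b [Ma Mb ->]]] /asboolP[c [d [Md Me ->]]].
  apply/asboolP; exists (a * c + b * d), (a * d + b * c).
  by split; [apply: (coneD Mc); exact: (coneM Mc)..|ring].
split; first by apply: cone_diff_cone; exact: (cone1 Mc).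
- move=> x y /asboolP[a [b [Ma Mb ->]]] /asboolP[c [d [Md Me ->]]].
  by apply/asboolP; exists (a + d), (b + c); split; [exact: (coneD Mc)..|ring].
- move=> x y xE yE; have [->|y0] := eqVneq y 0.
    by rewrite invr0 mulr0; apply: cone_diff_cone; exact: cone0.
  have -> : x / y = (x * y) * (y ^+ 2)^-1 by field.
  apply: (diffM _ _ (diffM _ _ xE yE)).
  by apply: cone_diff_cone; apply: (coneV Mc); exact: cone_diffX2.
Qed.

HB.instance Definition _ :=
  GRing.isDivringClosed.Build K cone_diff cone_diff_divring.

(** Otherwise the elements [a - x * b], with [a] and [b] in the cone, would form
    a larger cone: if [- 1] were among them, [x] would be a quotient of elements
    of the cone. *)
Lemma cone_total x : x \in cone_diff -> P x \/ P (- x).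
Proof.
move=> xE; have [Mx|Mx] := pselect (P x); first by left.
right; pose Q : set K := [set y | exists a b, [/\ P a, P b & y = a - x * b]].
have QE y : Q y -> y \in cone_diff.
  case=> a [b [/cone_diff_cone Ea /cone_diff_cone Eb ->]].
  by rewrite rpredB ?rpredM.
have MQ : P `<=` Q.
  by move=> y My; exists y, 0; split=> //; [exact: cone0|rewrite mulr0 subr0].
have QM y z : Q y -> Q z -> Q (y * z).
  move=> [a [b [Ma Mb ->]]] [c [d [Md Me ->]]].
  exists (a * c + x ^+ 2 * (b * d)), (a * d + b * c); split; last ring.
    apply: (coneD Mc); apply: (coneM Mc) => //; first exact: cone_diffX2.
    exact: (coneM Mc).
  by apply: (coneD Mc); exact: (coneM Mc).
apply: (@max_cone_max _ M Q _ MQ); last first.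
  by exists 0, 1; split; [exact: cone0|exact: (cone1 Mc)|rewrite mulr1 sub0r].
split.
- by apply: MQ; exact: (cone1 Mc).
- move=> _ _ [a [b [Ma Mb ->]]] [c [d [Md Me ->]]].
  by exists (a + c), (b + d); split; [exact: (coneD Mc)..|ring].
- exact: QM.
- move=> y Qy; have [->|y0] := eqVneq y 0.
    by rewrite invr0; apply/MQ/cone0.
  have -> : y^-1 = y * (y ^+ 2)^-1 by field.
  by apply: QM => //; apply: MQ; apply: (coneV Mc); apply/cone_diffX2/QE.
- by move=> y z /QE Ey /QE Ez; apply: MQ; apply: cone_diffX2; rewrite rpredB.
- case=> a [b [Ma Mb E]]; apply: Mx; have [b0|b0] := eqVneq b 0.
    by case: (coneN1 Mc); rewrite E b0 mulr0 subr0.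
  have -> : x = (1 + a) * b^-1.
    apply: (mulIf b0); rewrite divfK //; move/eqP: E.
    by rewrite eq_sym subr_eq => /eqP ->; ring.
  apply: (coneM Mc); last exact: (coneV Mc).
  by apply: (coneD Mc) => //; exact: (cone1 Mc).
Qed.

Lemma cone_anti x : P x -> P (- x) -> x = 0.
Proof.
move=> Mx MNx; apply/eqP; apply: contraT => x0; case: (coneN1 Mc).
have -> : -1 = - x * x^-1 by field.
by apply: (coneM Mc) => //; exact: (coneV Mc).
Qed.

Record cone_field := ConeField {
  cone_val : K;
  cone_valP : cone_val \in cone_diff }.

HB.instance Definition _ := [isSub for cone_val].
HB.instance Definition _ := [Choice of cone_field by <:].
HB.instance Definition _ := [SubChoice_isSubIntegralDomain of cone_field by <:].
HB.instance Definition _ := [SubIntegralDomain_isSubField of cone_field by <:].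

Lemma cone_val_zmod : zmod_morphism cone_val. Proof. by []. Qed.
Lemma cone_val_monoid : monoid_morphism cone_val. Proof. by []. Qed.
HB.instance Definition _ :=
  GRing.isZmodMorphism.Build cone_field K cone_val cone_val_zmod.
HB.instance Definition _ :=
  GRing.isMonoidMorphism.Build cone_field K cone_val cone_val_monoid.

Implicit Types x y : cone_field.

Definition cone_le x y := `[< P (cone_val y - cone_val x) >].
Definition cone_norm x := if cone_le 0 x then x else - x.

Lemma cone_le0 x : cone_le 0 x = `[< P (cone_val x) >].
Proof. by rewrite /cone_le rmorph0 subr0. Qed.

Lemma cone_le0_add x y : cone_le 0 x -> cone_le 0 y -> cone_le 0 (x + y).
Proof.
rewrite !cone_le0 => /asboolP Mx /asboolP My.
by apply/asboolP; exact: (coneD Mc).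
Qed.

Lemma cone_le0_mul x y : cone_le 0 x -> cone_le 0 y -> cone_le 0 (x * y).
Proof.
rewrite !cone_le0 => /asboolP Mx /asboolP My.
by apply/asboolP; exact: (coneM Mc).
Qed.

Lemma cone_le0_anti x : cone_le 0 x -> cone_le x 0 -> x = 0.
Proof.
rewrite cone_le0 => /asboolP Mx /asboolP; rewrite rmorph0 sub0r => MNx.
by apply: val_inj; rewrite rmorph0; exact: cone_anti.
Qed.

Lemma cone_sub_ge0 x y : cone_le 0 (y - x) = cone_le x y.
Proof. by rewrite cone_le0 rmorphB. Qed.

Lemma cone_le0_total x : cone_le 0 x || cone_le x 0.
Proof.
apply/orP; rewrite cone_le0 /cone_le rmorph0 sub0r.
by have [?|?] := cone_total (cone_valP x); [left|right]; apply/asboolP.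
Qed.

Lemma cone_normN x : cone_norm (- x) = cone_norm x.
Proof.
rewrite /cone_norm opprK; have := cone_le0_total x.
have -> : cone_le x 0 = cone_le 0 (- x) by rewrite -cone_sub_ge0 sub0r.
case: ifPn => [Nx|_]; last by rewrite orbF => ->.
case: ifPn => // x0 _; have -> : x = 0; last by rewrite oppr0.
by apply: cone_le0_anti => //; rewrite -cone_sub_ge0 sub0r.
Qed.

Lemma cone_ge0_norm x : cone_le 0 x -> cone_norm x = x.
Proof. by rewrite /cone_norm => ->. Qed.

HB.instance Definition _ := Num.IntegralDomain_isLeReal.Build cone_field
  cone_le0_add cone_le0_mul cone_le0_anti cone_sub_ge0 cone_le0_total
  cone_normN cone_ge0_norm (fun _ _ => erefl).

Lemma cone_field_le0 x : (0 <= x) = `[< P (cone_val x) >].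
Proof. exact: cone_le0. Qed.

End ConeField.

Lemma exists_rcf_of_cone (K : fieldType) (Q : set K) :
  (forall p : {poly K}, (1 < size p)%N -> exists x, root p x) -> is_cone Q ->
  exists (L : rcfType) (v : {rmorphism L -> K}),
    forall x, Q x -> exists2 y, 0 <= y & v y = x.
Proof.
move=> K_root /exists_maximal_cone[M QM].
pose L0 : realFieldType := cone_field M.
pose v : {rmorphism L0 -> K} := @cone_val K M.
have ivt : Num.real_closed_axiom L0.
  apply: (maximal_cone_ivt (v := v) K_root) => Q' Q'c vQ y Q'y.
  have My : max_cone M y.
    apply: (max_cone_max Q'c) Q'y => z Mz.
    have := vQ (ConeField (cone_diff_cone Mz)); apply.
    by rewrite cone_field_le0; apply/asboolP.
  by exists (ConeField (cone_diff_cone My)).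
pose L : rcfType := HB.pack L0 (Num.RealField_isClosed.Build L0 ivt).
exists L, v => x /QM Mx; exists (ConeField (cone_diff_cone Mx)) => //.
by rewrite (cone_field_le0 (ConeField (cone_diff_cone Mx))); apply/asboolP.
Qed.

(** The fractions of elements of [P] form a cone, so there is a real closed
    field [L] that contains the polynomials and in which the elements of [P] are
    nonnegative.  Every polynomial lies in [L], not only those of [P], because
    [4 p = (p + 1) ^ 2 - (p - 1) ^ 2].  The variables, seen in [L], are the
    point that descends to the reals. *)
Lemma exists_positive_point (R : realType) (n : nat) (P : set (mpoly n R))
    (hs : seq (mpoly n R)) :
  (forall p q, P p -> P q -> P (p + q)) ->
  (forall p q, P p -> P q -> P (p * q)) ->
  (forall p, P (p ^+ 2)) ->
  (forall p, P p -> P (- p) -> p = 0) ->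
  (forall h, h \in hs -> P h /\ h != 0) ->
  exists y : 'I_n -> R, forall h, h \in hs -> 0 < meval y h.
Proof.
move=> PD PM PX2 P_pointed hsP.
have [K [f [f_neq0 K_root]]] := exists_root_closed_field R n.
pose Q : set K := [set x | exists p q, [/\ P p, P q, q != 0 & x = f p / f q]].
have P1 : P 1 by rewrite -(expr1n _ 2); exact: PX2.
have fQ p : P p -> Q (f p).
  by move=> Pp; exists p, 1; split; rewrite ?oner_neq0 // rmorph1 divr1.
have Qc : is_cone Q.
  split.
  - by rewrite -(rmorph1 f); exact: fQ.
  - move=> _ _ [a [b [Pa Pb b0 ->]]] [c [d [Pc Pd d0 ->]]].
    exists (a * d + c * b), (b * d); split; rewrite ?mulf_neq0 //; auto.
    by rewrite rmorphD !rmorphM /=; field; rewrite !f_neq0.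
  - move=> _ _ [a [b [Pa Pb b0 ->]]] [c [d [Pc Pd d0 ->]]].
    exists (a * c), (b * d); split; rewrite ?mulf_neq0 //; auto.
    by rewrite !rmorphM /=; field; rewrite !f_neq0.
  - move=> _ [a [b [Pa Pb b0 ->]]]; have [a0|a0] := eqVneq a 0.
      by exists a, b; split=> //; rewrite a0 rmorph0 mul0r invr0.
    by exists b, a; split=> //; rewrite invf_div.
  - move=> _ _ [a [b [Pa Pb b0 ->]]] [c [d [Pc Pd d0 ->]]].
    exists ((a * d - c * b) ^+ 2), ((b * d) ^+ 2).
    split; rewrite ?expf_neq0 ?mulf_neq0 //.
    by rewrite !rmorphXn rmorphB !rmorphM /=; field; rewrite !f_neq0.
  - case=> a [b [Pa Pb b0 E]]; case/eqP: (b0); apply: P_pointed => //.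
    suff -> : - b = a by [].
    apply/eqP; rewrite -subr_eq0; apply: contraT => /f_neq0 /eqP; case.
    rewrite rmorphB rmorphN /=; apply: (mulIf (invr_neq0 (f_neq0 _ b0))).
    by rewrite mul0r mulrBl mulNr divff ?f_neq0 // -E subrr.
have [L [v vQ]] := exists_rcf_of_cone K_root Qc.
have v_inj : injective v := fmorph_inj v.
have /boolp.choice[g gE] : forall p, exists y, v y = f p.
  move=> p.
  have [x _ xE] := vQ _ (fQ _ (PX2 (p + 1))).
  have [y _ yE] := vQ _ (fQ _ (PX2 (p - 1))).
  have four0 : v 4 != 0 by rewrite fmorph_eq0 pnatr_eq0.
  exists ((x - y) / 4); rewrite fmorph_div rmorphB xE yE.
  apply: (mulIf four0); rewrite divfK // !rmorphXn rmorphD rmorphB rmorph1.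
  by rewrite rmorph_nat; ring.
have gB : zmod_morphism g.
  by move=> p q; apply: v_inj; rewrite rmorphB !gE rmorphB.
have gM : monoid_morphism g.
  split; first by apply: v_inj; rewrite gE !rmorph1.
  by move=> p q; apply: v_inj; rewrite rmorphM !gE rmorphM.
have {g gB gM gE}[g gE] : exists g : {rmorphism mpoly n R -> L},
    forall p, v (g p) = f p.
  pose g' : {rmorphism mpoly n R -> L} := HB.pack g
    (GRing.isZmodMorphism.Build _ _ g gB)
    (GRing.isMonoidMorphism.Build _ _ g gM).
  by exists g'.
pose iota : {rmorphism R -> L} := g \o @mpolyC n R.
pose t i := g (mpolyX R (mnm1 i)).
have gmmap p : mmap iota t p = g p.
  rewrite {2}[p]mpolyE rmorph_sum; apply: eq_bigr => m _.
  rewrite -mul_mpolyC rmorphM /=; congr (_ * _).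
  rewrite mpolyXE_id rmorph_prod.
  by apply: eq_bigr => i _; rewrite rmorphXn.
have [||y /allP Hy] := @exists_real_point n R L iota t hs.
- by move=> p p0; rewrite gmmap -(inj_eq v_inj) rmorph0 gE f_neq0.
- apply/allP => h /hsP[Ph h0].
  rewrite gmmap lt_neqAle eq_sym -(inj_eq v_inj) rmorph0.
  rewrite gE f_neq0 //=; have [z z0 zE] := vQ _ (fQ _ Ph).
  by have -> : g h = z by apply: v_inj; rewrite gE zE.
- by exists y.
Qed.

(** * Leading components and the quadratic module *)

Section Grading.
Variables (R : realType) (n : nat) (z : 'I_n -> int).
Implicit Types (p q : mpoly n R) (d e : int) (m : multinom n).

Definition zbounded p d := forall m, d < zweight z m -> mcoeff m p = 0.

Lemma zweightD m1 m2 : zweight z (mnm_add m1 m2) = zweight z m1 + zweight z m2.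
Proof.
rewrite /zweight -big_split; apply: eq_bigr => i _ /=.
by rewrite mnmDE PoszD mulrDr.
Qed.

Lemma zweight0 : zweight z mnm0 = 0.
Proof. by rewrite /zweight big1 // => i _; rewrite mnm0E mulr0. Qed.

Lemma zcompD d p q : zcomp z d (p + q) = zcomp z d p + zcomp z d q.
Proof.
apply/mpolyP => m; rewrite mcoeffD !mcoeff_zcomp mcoeffD.
by case: ifP; rewrite ?addr0.
Qed.

Lemma zcomp_zero d : zcomp z d (0 : mpoly n R) = 0.
Proof. by apply/mpolyP => m; rewrite mcoeff_zcomp mcoeff0 if_same. Qed.

Lemma zcomp_id d p : zcomp z d (zcomp z d p) = zcomp z d p.
Proof. by apply/mpolyP => m; rewrite !mcoeff_zcomp; case: eqP. Qed.

Lemma zbounded_zcomp d p : zbounded (zcomp z d p) d.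
Proof. by move=> m dm; rewrite mcoeff_zcomp gt_eqF. Qed.

Lemma zbounded0 d : zbounded (0 : mpoly n R) d.
Proof. by move=> m _; rewrite mcoeff0. Qed.

Lemma zboundedD d p q : zbounded p d -> zbounded q d -> zbounded (p + q) d.
Proof. by move=> pd qd m dm; rewrite mcoeffD pd ?qd ?addr0. Qed.

Lemma zbounded_zcomp0 d e p : zbounded p d -> d < e -> zcomp z e p = 0.
Proof.
move=> pd de; apply/mpolyP => m; rewrite mcoeff_zcomp mcoeff0.
by case: eqP => // me; rewrite pd // me.
Qed.

Lemma zboundedM d e p q :
  zbounded p d -> zbounded q e -> zbounded (p * q) (d + e).
Proof.
move=> pd qe m dem; rewrite mcoeffM big1 // => k.
move=> /eqP/(congr1 (zweight z)); rewrite zweightD => mE.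
have [dk|kd] := ltP d (zweight z k.1); first by rewrite pd ?mul0r.
rewrite qe ?mulr0 // -(ltrD2l d); apply: (lt_le_trans dem).
by rewrite mE lerD2r.
Qed.

Lemma zcompM d e p q : zbounded p d -> zbounded q e ->
  zcomp z (d + e) (p * q) = zcomp z d p * zcomp z e q.
Proof.
move=> pd qe; apply/mpolyP => m; rewrite mcoeff_zcomp !mcoeffM.
case: eqP => [mde|mde]; last first.
  rewrite big1 // => k /eqP/(congr1 (zweight z)); rewrite zweightD => mE.
  rewrite !mcoeff_zcomp.
  case: eqP => [k1d|_]; last by rewrite mul0r.
  case: eqP => [k2e|_]; last by rewrite mulr0.
  by case: mde; rewrite mE k1d k2e.
apply: eq_bigr => k /eqP/(congr1 (zweight z)); rewrite zweightD mde => kde.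
rewrite !mcoeff_zcomp.
case: (ltgtP (zweight z k.1) d) => [kd|dk|kd]; last first.
- by move: kde; rewrite kd => /addrI <-; rewrite eqxx.
- by rewrite pd ?mul0r.
- by rewrite (qe k.2) ?mul0r ?mulr0 // -(ltrD2l d) kde ltrD2r.
Qed.

Lemma zbounded1 : zbounded 1 0.
Proof.
by move=> m; rewrite mcoeff1; case: eqP => // ->; rewrite zweight0 ltxx.
Qed.

Lemma zcomp1 : zcomp z 0 (1 : mpoly n R) = 1.
Proof.
apply/mpolyP => m; rewrite mcoeff_zcomp mcoeff1.
have [->|_] := eqVneq m mnm0; last by rewrite if_same.
by rewrite zweight0 eqxx.
Qed.

Lemma zbounded_prod (I : Type) (l : seq I) (d : I -> int) (F : I -> mpoly n R) :
  (forall i, zbounded (F i) (d i)) ->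
  zbounded (\prod_(i <- l) F i) (\sum_(i <- l) d i) /\
  zcomp z (\sum_(i <- l) d i) (\prod_(i <- l) F i) =
    \prod_(i <- l) zcomp z (d i) (F i).
Proof.
move=> Fd; elim: l => [|i l [IHb IHc]].
  by rewrite !big_nil; split; [exact: zbounded1|exact: zcomp1].
rewrite !big_cons; split; first exact: zboundedM.
by rewrite zcompM // IHc.
Qed.

Lemma zdeg_bounded p : p != 0 ->
  exists d, [/\ zdeg z p = d%:E, zcomp z d p != 0 & zbounded p d].
Proof.
move=> p0; have [d [dE d0 dmax]] := zdegP z p0; exists d; split=> // m dm.
apply/eqP; apply: contraLR dm => pm; rewrite -leNgt; apply: dmax.
apply/eqP => /(congr1 (mcoeff m)); rewrite mcoeff_zcomp eqxx mcoeff0.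
exact/eqP.
Qed.

Lemma zdeg_top p d : zbounded p d -> zcomp z d p != 0 -> zdeg z p = d%:E.
Proof.
move=> pd pd0; have p0 : p != 0.
  by apply: contraNneq pd0 => ->; rewrite zcomp_zero.
have [e [-> e0 emax]] := zdegP z p0; congr (_%:E); apply/eqP.
rewrite eq_le emax // andbT leNgt.
by apply: contra e0 => de; apply/eqP; exact: zbounded_zcomp0 de.
Qed.

Lemma zdeg_ge p d :
  (d%:E <= zdeg z p)%E -> exists2 e, d <= e & zcomp z e p != 0.
Proof.
have [->|p0] := eqVneq p 0; first by rewrite zdeg0.
by have [e [-> e0 _]] := zdegP z p0; rewrite lee_fin => de; exists e.
Qed.

End Grading.

Section StableModule.
Variables (R : realType) (n s : nat) (f : 'I_s -> mpoly n R).
Local Notation M := (quadratic_module f).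

Lemma sum_of_squares0 : sum_of_squares (0 : mpoly n R).
Proof. by exists [::]; rewrite big_nil. Qed.

Lemma sum_of_squares_sqr (p : mpoly n R) : sum_of_squares (p ^+ 2).
Proof. by exists [:: p]; rewrite big_seq1. Qed.

Lemma sum_of_squaresD (p q : mpoly n R) :
  sum_of_squares p -> sum_of_squares q -> sum_of_squares (p + q).
Proof. by move=> [t ->] [u ->]; exists (t ++ u); rewrite big_cat. Qed.

Lemma quadratic_moduleD p q : M p -> M q -> M (p + q).
Proof.
move=> [a0 [a [a0s asq ->]]] [b0 [b [b0s bsq ->]]].
exists (a0 + b0), (fun i => a i + b i); split.
- exact: sum_of_squaresD.
- by move=> i; exact: sum_of_squaresD.
- by under [in RHS]eq_bigr do rewrite mulrDl; rewrite big_split /= addrACA.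
Qed.

Lemma quadratic_module_sqr p : M (p ^+ 2).
Proof.
exists (p ^+ 2), (fun=> 0); split.
- exact: sum_of_squares_sqr.
- by move=> _; exact: sum_of_squares0.
- by rewrite big1 ?addr0 // => i _; rewrite mul0r.
Qed.

Lemma quadratic_module0 : M 0.
Proof.
have -> : 0 = 0 ^+ 2 :> mpoly n R by rewrite expr0n.
exact: quadratic_module_sqr.
Qed.

Lemma quadratic_module_gen i : M (f i).
Proof.
exists 0, (fun j => (j == i)%:R); split.
- exact: sum_of_squares0.
- move=> j; case: (j == i); last exact: sum_of_squares0.
  by rewrite -[true%:R](expr1n _ 2); exact: sum_of_squares_sqr.
- rewrite (bigD1 i) //= eqxx mul1r big1 ?add0r ?addr0 // => j /negbTE ->.
  by rewrite mul0r.
Qed.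

End StableModule.

Lemma exists_max_seq (T : eqType) (w : T -> int) (r : seq T) x :
  x \in r -> exists2 y, y \in r & forall t, t \in r -> w t <= w y.
Proof.
elim: r x => // a r IH x _; case: r IH => [|b r] IH.
  by exists a; rewrite ?mem_head // => t; rewrite inE => /eqP ->.
have [y yr ymax] := IH b (mem_head _ _).
have [ay|ya] := leP (w a) (w y).
  exists y; first by rewrite inE yr orbT.
  by move=> t; rewrite inE => /predU1P[->|/ymax].
exists a; first exact: mem_head.
by move=> t; rewrite inE => /predU1P[->//|/ymax /le_trans]; apply; exact: ltW.
Qed.

Section LeadingForms.
Variables (R : realType) (n s : nat) (f : 'I_s -> mpoly n R) (z : 'I_n -> int).
Local Notation M := (quadratic_module f).

Definition lifts_to_module p d a :=
  [/\ M a, zbounded z a d, zbounded z p d, zcomp z d a = zcomp z d p &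
      zcomp z d p != 0].

Lemma zcomp_sum (T : Type) (r : seq T) (F : T -> mpoly n R) d :
  zcomp z d (\sum_(t <- r) F t) = \sum_(t <- r) zcomp z d (F t).
Proof.
by elim/big_rec2: _ => [|t p q _ <-]; [exact: zcomp_zero|exact: zcompD].
Qed.

(** Compare the components of the greatest top weight [D]: the lifts of the
    polynomials that reach [D] sum to an element of degree less than [D], so the
    degree of one of them has dropped by adding the others. *)
Lemma totally_stable_sum_eq0 (ps : seq (mpoly n R)) : totally_stable z M ->
  (forall p, p \in ps -> p != 0 -> exists d a, lifts_to_module p d a) ->
  \sum_(p <- ps) p = 0 -> forall p, p \in ps -> p = 0.
Proof.
move=> M_stable ps_lift ps0 p pps; apply/eqP; apply: contraT => p0.
have /boolp.choice[F HF] : forall p, exists da : int * mpoly n R,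
    p \in ps -> p != 0 -> lifts_to_module p da.1 da.2.
  move=> q; have [[d [a H]]|H] := pselect (exists d a, lifts_to_module q d a).
    by exists (d, a).
  by exists (0, 0) => /ps_lift + /[dup] q0 => /(_ q0) /H.
have [|q] := @exists_max_seq _ (fun q => (F q).1) [seq q <- ps | q != 0] p.
  by rewrite mem_filter p0.
rewrite mem_filter => /andP[q0 qps] qmax; set D := (F q).1 in qmax.
pose m t := if (t != 0) && ((F t).1 == D) then (F t).2 else 0.
have Mm t : t \in ps -> M (m t).
  move=> tps; rewrite /m; case: ifPn => [/andP[t0 _]|_]; last first.
    exact: quadratic_module0.
  by case: (HF _ tps t0).
have mD t : t \in ps -> zbounded z (m t) D /\ zcomp z D (m t) = zcomp z D t.
  move=> tps; rewrite /m; have [->|t0] := eqVneq t 0.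
    by split => //; exact: zbounded0.
  have [Ma ab tb ac t_top] := HF _ tps t0.
  case: eqP => /= [<-|/eqP tD]; first by split.
  split; first exact: zbounded0.
  rewrite zcomp_zero (zbounded_zcomp0 tb) // lt_neqAle tD /=.
  by apply: qmax; rewrite mem_filter t0.
have mq : zdeg z (m q) = D%:E.
  have [qb qc] := mD _ qps; apply: zdeg_top => //; rewrite qc.
  by case: (HF _ qps q0).
pose S := \sum_(t <- rem q ps) m t.
have MS : M S.
  rewrite /S big_seq.
  elim/big_rec: _ => [|t u tps Mu]; first exact: quadratic_module0.
  by apply: quadratic_moduleD => //; apply: Mm; exact: mem_rem tps.
have tot : m q + S = \sum_(t <- ps) m t by rewrite (big_rem q qps).
have tot_b : zbounded z (m q + S) D.
  rewrite tot big_seq; elim/big_rec: _ => [|t u tps ub]; first exact: zbounded0.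
  by apply: zboundedD => //; case: (mD _ tps).
have tot_c : zcomp z D (m q + S) = 0.
  transitivity (zcomp z D (\sum_(t <- ps) t)); last by rewrite ps0 zcomp_zero.
  by rewrite tot !zcomp_sum; apply: eq_big_seq => t /mD[].
have := M_stable _ _ (Mm _ qps) MS; rewrite mq => /zdeg_ge[e].
rewrite le_eqVlt => /predU1P[<-|De]; first by rewrite tot_c eqxx.
by rewrite (zbounded_zcomp0 tot_b De) eqxx.
Qed.

(** Zero generators are replaced by [1], which changes neither the module nor
    the conclusion, so that all leading components [h i] are nonzero. *)
Lemma leading_forms_positive_point :
  mul_closed M -> totally_stable z M ->
  exists (d : 'I_s -> int) (y : 'I_n -> R), forall i, zbounded z (f i) (d i) /\
    (f i != 0 -> 0 < meval y (zcomp z (d i) (f i))).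
Proof.
move=> M_mul M_stable.
have /boolp.choice[d dP] : forall i, exists d, zbounded z (f i) d /\
    (f i != 0 -> zcomp z d (f i) != 0).
  move=> i; have [->|fi0] := eqVneq (f i) 0.
    by exists 0; split=> //; exact: zbounded0.
  by have [e [_ e0 eb]] := zdeg_bounded z fi0; exists e.
pose g i := if f i == 0 then 1 else f i.
pose D i := if f i == 0 then 0 else d i.
pose h i := zcomp z (D i) (g i).
have gb i : zbounded z (g i) (D i).
  by rewrite /g /D; case: eqP => _; [exact: zbounded1|case: (dP i)].
have h0 i : h i != 0.
  rewrite /h /g /D; have [_|fi0] := eqVneq (f i) 0.
    by rewrite zcomp1 oner_neq0.
  by case: (dP i) => _; apply.
have Mg i : M (g i).
  rewrite /g; case: eqP => _; last exact: quadratic_module_gen.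
  by rewrite -(expr1n _ 2); exact: quadratic_module_sqr.
have Mprod (l : seq 'I_s) : M (\prod_(i <- l) g i).
  elim/big_rec: _ => [|i p _ Mp]; last exact: M_mul.
  by rewrite -(expr1n _ 2); exact: quadratic_module_sqr.
(* The term [q ^ 2 * prod h_i] is lifted by [q_a ^ 2 * prod g_i], with [a] the
   degree of [q]. *)
pose term (t : mpoly n R * seq 'I_s) := t.1 ^+ 2 * \prod_(i <- t.2) h i.
pose P : set (mpoly n R) := [set p | exists ts, p = \sum_(t <- ts) term t].
have term_lift t : term t != 0 -> exists e a, lifts_to_module (term t) e a.
  case: t => q l; rewrite /term /= => t0.
  have q0 : q != 0 by apply: contraNneq t0 => ->; rewrite expr0n mul0r.
  have [a [_ a0 ab]] := zdeg_bounded z q0.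
  have hD i : zbounded z (h i) (D i) by exact: zbounded_zcomp.
  have [hb hc] := zbounded_prod l hD.
  have [gb' gc] := zbounded_prod l gb.
  have cb : zbounded z (zcomp z a q) a by exact: zbounded_zcomp.
  exists (a + a + \sum_(i <- l) D i), (zcomp z a q ^+ 2 * \prod_(i <- l) g i).
  have hc' : zcomp z (\sum_(i <- l) D i) (\prod_(i <- l) h i) =
      \prod_(i <- l) h i.
    by rewrite hc; apply: eq_bigr => i _; exact: zcomp_id.
  have tc : zcomp z (a + a + \sum_(i <- l) D i) (q ^+ 2 * \prod_(i <- l) h i) =
      zcomp z a q ^+ 2 * \prod_(i <- l) h i.
    by rewrite zcompM // ?hc' expr2 ?zcompM //; exact: zboundedM.
  split.
  - by apply: M_mul => //; exact: quadratic_module_sqr.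
  - by apply: zboundedM => //; rewrite expr2; exact: zboundedM.
  - by apply: zboundedM => //; rewrite expr2; exact: zboundedM.
  - by rewrite tc !expr2 !zcompM ?zcomp_id ?gc //; exact: zboundedM.
  - rewrite tc mulf_neq0 ?expf_neq0 //.
    by rewrite prodf_seq_neq0; apply/allP => i _; rewrite h0.
have [|||||y Hy] := @exists_positive_point R n P [seq h i | i <- enum 'I_s].
- by move=> _ _ [ts ->] [us ->]; exists (ts ++ us); rewrite big_cat.
- move=> _ _ [ts ->] [us ->].
  exists [seq (t.1 * u.1, t.2 ++ u.2) | t <- ts, u <- us].
  rewrite big_allpairs_dep mulr_suml; apply: eq_bigr => t _; rewrite mulr_sumr.
  by apply: eq_bigr => u _; rewrite /term /= big_cat exprMn mulrACA.
- by move=> p; exists [:: (p, [::])]; rewrite big_seq1 /term big_nil mulr1.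
- move=> p [ts pE] [us NpE].
  have E : \sum_(q <- [seq term t | t <- ts ++ us]) q = 0.
    by rewrite big_map big_cat /= -pE -NpE subrr.
  have H := totally_stable_sum_eq0 M_stable _ E.
  rewrite pE big_seq big1 // => t tts; apply: H.
    by move=> _ /mapP[u _ ->]; exact: term_lift.
  by apply: map_f; rewrite mem_cat tts.
- move=> _ /mapP[i _ ->]; split=> //; exists [:: (1, [:: i])].
  by rewrite big_seq1 /term /= big_seq1 expr1n mul1r.
exists d, y => i; split; first by case: (dP i).
move=> fi0; have := Hy (h i); rewrite /h /g /D (negbTE fi0); apply.
by apply/mapP; exists i; rewrite ?mem_enum // /h /g /D (negbTE fi0).
Qed.

End LeadingForms.

(** * Rescaling along a tentacle *)

Section Rescaling.
Variables (R : realType) (n : nat) (z : 'I_n -> int).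
Implicit Types (p : mpoly n R) (d : int) (mu l : R) (v : 'I_n -> R).

(** [mu ^ d * p (mu ^ - z_1 v_1, ..., mu ^ - z_n v_n)], written so that it makes
    sense at [mu = 0]; the exponents are the nonnegative differences between [d]
    and the weights of [p], when [d] bounds these. *)
Definition rescaled d p mu v : R :=
  \sum_(m <- msupp p)
    mcoeff m p * mu ^+ `|d - zweight z m|%N * \prod_i v i ^+ m i.

Lemma rescaled0 d p v : rescaled d p 0 v = meval v (zcomp z d p).
Proof.
rewrite /zcomp /rescaled raddf_sum /= [RHS]big_mkcond; apply: eq_bigr => m _.
case: eqP => [->|/eqP wd].
  by rewrite subrr expr0 mulr1 mevalZ mevalX.
by rewrite expr0n absz_eq0 subr_eq0 eq_sym (negbTE wd) mulr0 mul0r.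
Qed.

Lemma rescaledE d p l v : l != 0 -> zbounded z p d ->
  meval (fun i => l ^ z i * v i) p = l ^ d * rescaled d p l^-1 v.
Proof.
move=> l0 pd; rewrite mevalE /rescaled mulr_sumr [LHS]big_seq [RHS]big_seq.
apply: eq_bigr => m mp.
have wd : zweight z m <= d.
  rewrite leNgt; apply: contraL mp => /pd m0.
  by rewrite -mcoeff_eq0 m0.
have -> : \prod_i (l ^ z i * v i) ^+ m i =
    l ^ zweight z m * \prod_i v i ^+ m i.
  under eq_bigr do rewrite exprMn; rewrite big_split /=; congr (_ * _).
  rewrite /zweight; elim/big_rec2: _ => [|i x y _ ->]; first by rewrite expr0z.
  by rewrite expfzDr // exprnP exprz_exp.
have -> : l^-1 ^+ `|d - zweight z m|%N = l ^ (zweight z m - d).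
  by rewrite exprnP gez0_abs ?subr_ge0 // exprz_inv opprB.
have -> : l ^ zweight z m = l ^ d * l ^ (zweight z m - d).
  by rewrite -expfzDr // addrC subrK.
ring.
Qed.

Lemma cvg_rescaled (T : Type) (F : set_system T) (FF : Filter F) d p
    (mu : T -> R) (v : T -> 'I_n -> R) (mu0 : R) (v0 : 'I_n -> R) :
  mu t @[t --> F] --> mu0 -> (forall i, v t i @[t --> F] --> v0 i) ->
  rescaled d p (mu t) (v t) @[t --> F] --> rescaled d p mu0 v0.
Proof.
move=> mu_cvg v_cvg; have exp_cvg (u : T -> R) (u0 : R) k :
    u t @[t --> F] --> u0 -> u t ^+ k @[t --> F] --> u0 ^+ k.
  move=> u_cvg.
  exact: (@cvg_comp _ _ _ u (fun x => x ^+ k) F (nbhs u0) (nbhs (u0 ^+ k))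
    u_cvg (@exprn_continuous R k u0)).
apply: cvg_big => [|m _]; first exact: add_continuous.
apply: cvgM; first by apply: cvgM; [exact: cvg_cst|exact: exp_cvg].
by apply: cvg_big => [|i _]; [exact: mul_continuous|exact: exp_cvg].
Qed.

End Rescaling.

Section StableTentacle.
Variables (R : realType) (n s : nat) (f : 'I_s -> mpoly n R) (z : 'I_n -> int).

(** The rescaled generators are nonnegative for [|mu| < a] and [v] in the box of
    radius [b] around [y].  With [l0 >= 2 / a], the box of radius [b / 2], moved
    along by [l0], is the compact set: the points of its tentacle correspond to
    parameters [mu = 1 / (l * l0) < a]. *)
Lemma tentacle_of_positive_point (d : 'I_s -> int) (y : 'I_n -> R) :
  (forall i, zbounded z (f i) (d i) /\
    (f i != 0 -> 0 < meval y (zcomp z (d i) (f i)))) ->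
  exists2 K : set 'rV[R]_n,
    compact_with_interior K & tentacle K z `<=` basic_closed f.
Proof.
move=> fd; pose y0 : 'rV[R]_n := \row_j y j.
pose ge0_at (t : R * 'rV[R]_n) i :=
  0 <= rescaled z (d i) (f i) t.1 (fun j => t.2 ord0 j).
have near_ge0 i : nbhs ((0 : R), y0) [set t | ge0_at t i].
  have [fb f_pos] := fd i; have [fi0|fi0] := eqVneq (f i) 0.
    apply: filterS filterT => t _.
    by rewrite /= /ge0_at fi0 /rescaled msupp0 big_nil.
  have cvg_f : rescaled z (d i) (f i) t.1 (fun j => (t.2 : 'rV[R]_n) ord0 j)
      @[t --> ((0 : R), y0)] --> rescaled z (d i) (f i) 0 (fun j => y0 ord0 j).
    apply: cvg_rescaled => [|j]; first exact: cvg_fst.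
    apply: (@cvg_comp _ _ _ snd (fun v : 'rV[R]_n => v ord0 j)).
      exact: cvg_snd.
    exact: coord_continuous.
  have lim_pos : 0 < rescaled z (d i) (f i) 0 (fun j => y0 ord0 j).
    rewrite rescaled0 (@meval_eq _ _ _ y) ?f_pos // => j.
    by rewrite mxE.
  by apply: filterS (cvgr_gt _ cvg_f _ lim_pos) => t /ltW.
have : nbhs ((0 : R), y0) [set t | forall i, ge0_at t i].
  exact: (@filter_forall _ _ (fun i => [set t | ge0_at t i]) _
    (nbhs_filter _) near_ge0).
case=> [[A B] /= [/nbhs_ballP[a /= a0 aA] /nbhs_ballP[b /= b0 bB] AB]].
pose l0 := Num.max 1 (2 / a).
have l0_ge1 : 1 <= l0 by rewrite le_max lexx.
have l0_gt0 : 0 < l0 := lt_le_trans ltr01 l0_ge1.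
have l0z j : 0 < l0 ^ z j by exact: exprz_gt0.
pose K : set 'rV[R]_n := [set v : 'rV[R]_n | forall j,
  [set` `[l0 ^ z j * (y j - b / 2), l0 ^ z j * (y j + b / 2)]] (v ord0 j)].
exists K; first split.
- apply: (@rV_compact R n (fun j =>
    [set` `[l0 ^ z j * (y j - b / 2), l0 ^ z j * (y j + b / 2)]])) => j.
  exact: segment_compact.
- pose c : 'rV[R]_n := \row_j (l0 ^ z j * y j).
  exists c; rewrite /interior.
  apply: (@filter_forall _ _ (fun j => [set v : 'rV[R]_n | [set` `[l0 ^ z j *
    (y j - b / 2), l0 ^ z j * (y j + b / 2)]] (v ord0 j)]) _
    (nbhs_filter _)) => j.
  have cvg_j : (v : 'rV[R]_n) ord0 j @[v --> c] --> c ord0 j.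
    exact: coord_continuous.
  have lo : l0 ^ z j * (y j - b / 2) < c ord0 j by rewrite mxE ltr_pM2l //; lra.
  have hi : c ord0 j < l0 ^ z j * (y j + b / 2) by rewrite mxE ltr_pM2l //; lra.
  apply: filterS2 (cvgr_gt _ cvg_j _ lo) (cvgr_lt _ cvg_j _ hi).
  move=> v /ltW vlo /ltW vhi.
  by rewrite /= in_itv /= vlo.
- move=> _ [l [x [l1 Kx ->]]] i.
  have l_gt0 : 0 < l := lt_le_trans ltr01 l1.
  have ll0 : l * l0 != 0 by rewrite mulf_neq0 // gt_eqF.
  pose u j := (l0 ^ z j)^-1 * x ord0 j.
  rewrite (@meval_eq _ _ _ (fun j => (l * l0) ^ z j * u j)); last first.
    by move=> j; rewrite mxE expfzMl /u -mulrA mulVKf // gt_eqF.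
  have [fb _] := fd i; rewrite (rescaledE _ ll0 fb) mulr_ge0 //.
    by rewrite exprz_ge0 // mulr_ge0 // ltW.
  suff /(_ i) : forall i, ge0_at ((l * l0)^-1, \row_j u j) i.
    rewrite /ge0_at /=; congr (0 <= rescaled _ _ _ _ _).
    by apply/funext => j; rewrite mxE.
  apply: AB; split; [apply: aA|apply: bB] => /=.
    rewrite /ball /= sub0r normrN gtr0_norm ?invr_gt0 ?mulr_gt0 //.
    rewrite invf_plt ?posrE ?mulr_gt0 //.
    have : 2 / a <= l0 by rewrite le_max lexx orbT.
    have : l0 <= l * l0 by rewrite ler_peMl // ltW.
    by have : 0 < a^-1 by [rewrite invr_gt0]; move: (l * l0) => k; lra.
  split=> // j1 j; rewrite !mxE /ball /= /u.
  have := Kx j; rewrite /= in_itv /= => /andP[].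
  rewrite -!(ler_pdivlMl _ _ (l0z j)) -!(ler_pdivrMl _ _ (l0z j)).
  by rewrite ltr_norml; lra.
Qed.

End StableTentacle.

Section ReversePolynomial.
Variable F : fieldType.
Implicit Types (p : {poly F}) (x : F).

(** The reciprocal polynomial, through which [p] is followed to infinity. *)
Definition rev_poly p : {poly F} := \poly_(k < size p) p`_((size p).-1 - k).

Lemma rev_poly0 p : (rev_poly p).[0] = lead_coef p.
Proof.
rewrite horner_coef0 coef_poly subn0 /lead_coef.
by case: ltnP => //; rewrite leqn0 size_poly_eq0 => /eqP ->; rewrite coef0.
Qed.

Lemma horner_inv p x : x != 0 ->
  p.[x^-1] * x ^+ (size p).-1 = (rev_poly p).[x].
Proof.
move=> x0; rewrite horner_coef horner_poly mulr_suml.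
rewrite (reindex_inj rev_ord_inj) /=.
apply: eq_bigr => k _; rewrite -mulrA.
have -> : (size p - k.+1 = (size p).-1 - k)%N by rewrite -subn1 -subnDA add1n.
congr (_ * _).
have kp : (k <= (size p).-1)%N by rewrite -ltnS (ltn_predK (ltn_ord k)).
by rewrite -{2}(subnK kp) exprD mulrA -exprMn mulVf // expr1n mul1r.
Qed.

End ReversePolynomial.

Section RationalTentacle.
Variables (R : realType) (n s : nat) (f : 'I_s -> mpoly n R) (z : 'I_n -> int).
Local Notation M := (quadratic_module f).

Lemma sum_of_squares_ge0 (p : mpoly n R) (y : 'I_n -> R) :
  sum_of_squares p -> 0 <= meval y p.
Proof.
case=> t ->; rewrite raddf_sum /= sumr_ge0 // => q _.
by rewrite expr2 mevalM -expr2 sqr_ge0.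
Qed.

Lemma quadratic_module_ge0 p (x : 'rV[R]_n) :
  M p -> basic_closed f x -> 0 <= meval (fun j => x ord0 j) p.
Proof.
case=> p0 [p' [p0s ps ->]] fx; rewrite mevalD; apply: addr_ge0.
  exact: sum_of_squares_ge0.
rewrite raddf_sum /= sumr_ge0 // => i _; rewrite mevalM; apply: mulr_ge0.
  exact: sum_of_squares_ge0.
exact: fx.
Qed.

(** With [mu = 1 / l], the [i]-th rational function is [l ^ z_i * psi_i mu],
    where [psi_i] tends to the quotient [c_i] of the leading coefficients.  So
    the values of [p] along the tentacle are, up to a power of [l], those of its
    rescaling at [(mu, psi mu * x)], which tend to the value of [p_d] at
    [c * x]. *)
Lemma rational_tentacle_leading_ge0 (K : set 'rV[R]_n)
    (phi : 'I_n -> {fraction {poly R}}) :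
  (forall i, phi i != 0) -> (forall i, rat_deg (phi i) = z i) ->
  rational_tentacle K phi `<=` basic_closed f ->
  exists2 c : 'I_n -> R, forall i, c i != 0 &
  forall p d x, M p -> zbounded z p d -> K x ->
    0 <= meval (fun i => c i * x ord0 i) (zcomp z d p).
Proof.
move=> phi0 phi_deg Tf.
pose a i := rat_num (phi i); pose b i := rat_den (phi i).
have [a0 b0] : (forall i, a i != 0) /\ (forall i, b i != 0).
  split=> i; have [E den0 _] := rat_num_den (phi i) => //.
  apply: contraNneq (phi0 i); rewrite E /a => ->.
  by rewrite tofrac0 mul0r.
exists (fun i => lead_coef (a i) / lead_coef (b i)) => [i|p d x Mp pd Kx].
  by rewrite mulf_neq0 ?invr_eq0 ?lead_coef_eq0.
pose psi i mu := (rev_poly (a i)).[mu] / (rev_poly (b i)).[mu].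
have psi_cvg i : psi i mu @[mu --> 0^'+] --> lead_coef (a i) / lead_coef (b i).
  apply: cvg_at_right_filter; rewrite -!rev_poly0; apply: cvgM.
    exact: continuous_horner.
  apply: cvgV; first by rewrite rev_poly0 lead_coef_eq0.
  exact: continuous_horner.
have lim : rescaled z d p mu (fun i => psi i mu * x ord0 i) @[mu --> 0^'+] -->
    rescaled z d p 0 (fun i => lead_coef (a i) / lead_coef (b i) * x ord0 i).
  apply: cvg_rescaled; first by apply: cvg_at_right_filter; exact: cvg_id.
  by move=> i; apply: cvgM; [exact: psi_cvg|exact: cvg_cst].
rewrite -rescaled0; apply: (cvgr_to_ge lim).
have den_near : \forall mu \near 0^'+, forall i, (rev_poly (b i)).[mu] != 0.
  apply: (@filter_forall _ _
    (fun i => [set mu | (rev_poly (b i)).[mu] != 0])) => i.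
  have cb : (rev_poly (b i)).[mu] @[mu --> 0^'+] --> (rev_poly (b i)).[0].
    by apply: cvg_at_right_filter; exact: continuous_horner.
  by apply: (cvgr_neq0 _ cb); rewrite rev_poly0 lead_coef_eq0.
near=> mu.
have mu0 : 0 < mu by near: mu; exact: nbhs_right_gt.
have mu1 : mu <= 1 by near: mu; exact: nbhs_right_le.
have den0 i : (rev_poly (b i)).[mu] != 0.
  by move: i; near: mu.
have bE i : (b i).[mu^-1] != 0.
  have := den0 i; rewrite -(horner_inv _ (lt0r_neq0 mu0)).
  by rewrite mulf_eq0 negb_or => /andP[].
pose y : 'rV[R]_n := \row_i (rat_eval (phi i) mu^-1 * x ord0 i).
have Ty : basic_closed f y.
  apply: Tf; exists mu^-1, x.
  by split=> [|i||] //; [rewrite invf_ge1 | exact: bE].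
have l0 : mu^-1 != 0 by rewrite invr_eq0 gt_eqF.
have := quadratic_module_ge0 Mp Ty.
rewrite (@meval_eq _ _ _ (fun i => mu^-1 ^ z i * (psi i mu * x ord0 i)));
  last first.
  move=> i; rewrite mxE mulrA; congr (_ * _).
  rewrite /rat_eval -/(a i) -/(b i) /psi -!(horner_inv _ (lt0r_neq0 mu0)).
  have -> : z i = (size (a i)).-1%:Z - (size (b i)).-1%:Z.
    rewrite -phi_deg /rat_deg -/(a i) -/(b i).
    move: (a0 i) (b0 i); rewrite -!size_poly_gt0.
    move: (size (a i)) (size (b i)) => [|k] [|k'] // _ _.
    by rewrite /= !intS; ring.
  rewrite expfzDr // -exprnP -exprnN !exprVn.
  have mu_neq0 k : mu ^+ k != 0 by rewrite expf_neq0 // gt_eqF.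
  move: (bE i) (mu_neq0 (size (a i)).-1) (mu_neq0 (size (b i)).-1).
  move: (a i).[_] (b i).[_] (mu ^+ _) (mu ^+ _) => A B u w B0 u0 w0.
  by field; rewrite B0 u0 w0.
by rewrite (rescaledE _ l0 pd) invrK pmulr_rge0 // exprz_gt0 // invr_gt0.
Unshelve. all: by end_near.
Qed.

Lemma rational_tentacle_totally_stable :
  (exists2 T : set 'rV[R]_n,
      rational_tentacle_of_degree z T & T `<=` basic_closed f) ->
  totally_stable z M.
Proof.
case=> _ [K [phi [[_ [x0 Kx0]] phi0 -> phi_deg]]] Tf p q Mp Mq.
have [c c0 lead_ge0] := rational_tentacle_leading_ge0 phi0 phi_deg Tf.
have [->|p0] := eqVneq p 0; first by rewrite zdeg0 leNye.
have [d [-> dp pd]] := zdeg_bounded z p0.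
rewrite leNgt; apply/negP => pqd.
have pq_comp e : d <= e -> zcomp z e p + zcomp z e q = 0.
  move=> de; rewrite -zcompD; have [->|pq0] := eqVneq (p + q) 0.
    exact: zcomp_zero.
  have [d' [E _ pqb]] := zdeg_bounded z pq0.
  by apply: (zbounded_zcomp0 pqb); apply: lt_le_trans de; rewrite -lte_fin -E.
have qd : zbounded z q d.
  move=> m dm; have := pq_comp _ (ltW dm).
  rewrite (zbounded_zcomp0 pd dm) add0r.
  by move=> /(congr1 (mcoeff m)); rewrite mcoeff_zcomp eqxx mcoeff0.
have lead0 x : K x -> meval (fun i => c i * x ord0 i) (zcomp z d p) = 0.
  move=> Kx; apply/eqP; rewrite eq_le lead_ge0 // andbT.
  have /eqP := pq_comp d (lexx _); rewrite addr_eq0 => /eqP ->.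
  by rewrite mevalN oppr_le0 lead_ge0.
move: Kx0 => /nbhs_ballP[r /= r0 Kr].
have [|y yx /eqP[]] := @exists_meval_neq0_near n R (zcomp z d p)
    (fun i => c i * x0 ord0 i) (fun i => `|c i| * r) _ dp.
  by move=> i; rewrite mulr_gt0 // normr_gt0.
pose x : 'rV[R]_n := \row_i (y i / c i).
rewrite (@meval_eq _ _ _ (fun i => c i * x ord0 i)); last first.
  by move=> i; rewrite mxE mulrC divfK.
apply: lead0; apply: Kr; split=> // j i; rewrite mxE /ball /= (ord1 j).
rewrite -(ltr_pM2l (_ : 0 < `|c i|)) ?normr_gt0 // -normrM mulrBr.
by rewrite mulrCA divff // mulr1 distrC.
Qed.

End RationalTentacle.

Unset Implicit Arguments.

Theorem theorem4p2p10 (R : realType) (n s : nat) (f : 'I_s -> mpoly n R)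
    (z : 'I_n -> int) :
  ((exists2 T : set 'rV[R]_n,
      rational_tentacle_of_degree z T & T `<=` basic_closed f) ->
    totally_stable z (quadratic_module f))
  /\
  (mul_closed (quadratic_module f) ->
    totally_stable z (quadratic_module f) ->
    exists2 K : set 'rV[R]_n,
      compact_with_interior K & tentacle K z `<=` basic_closed f).
Proof.
split; first exact: rational_tentacle_totally_stable.
move=> M_mul M_stable.
have [d [y fd]] := leading_forms_positive_point M_mul M_stable.
exact: tentacle_of_positive_point fd.
Qed.
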